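(* (Generalized Sakaguchi Theorem) Let $F$ be a Finsler metric on a manifold $M$ of dimension $n\ge2$. If $F$ is a weakly-Weyl Finsler metric, then $F$ is a GDW-metric.
   Context: Let $F$ be a Finsler metric on an $n$-dimensional manifold $M$ with standard local coordinates $(x^i,y^i)$ on $TM$; all tensors below live on $TM\setminus\{0\}$. A subscript ''$._k$'' denotes $\partial/\partial y^k$. The spray coefficients are $G^i=\frac14 g^{il}\{(F^2)_{x^ky^l}y^k-(F^2)_{x^l}\}$, where $g_{ij}=\frac12(F^2)_{y^iy^j}$. A subscript ''$|_m$'' denotes the horizontal covariant derivative of the Berwald connection of $F$; e.g. with $N^r{}_m=G^r{}_{.m}$ and $G^i{}_{rm}=G^i{}_{.r.m}$, $T^i{}_{j|m}=\partial_{x^m}T^i{}_j-N^r{}_mT^i{}_{j.r}+G^i{}_{rm}T^r{}_j-G^r{}_{jm}T^i{}_r$, and similarly for other tensors. The subscript $0$ denotes contraction with $y$, e.g. $T_{|0}=T_{|m}y^m$. Riemann curvature: $R^i{}_k=2\frac{\partial G^i}{\partial x^k}-\frac{\partial^2G^i}{\partial x^m\partial y^k}y^m+2G^m\frac{\partial^2G^i}{\partial y^m\partial y^k}-\frac{\partial G^i}{\partial y^m}\frac{\partial G^m}{\partial y^k}$. Weyl curvature: $W^i{}_k=A^i{}_k-\frac1{n+1}A^m{}_{k.m}y^i$, where $A^i{}_k=R^i{}_k-R\,\delta^i{}_k$ and $R=\frac1{n-1}R^m{}_m$. Set $W_j{}^i{}_{pl}=\frac13\big(W^i{}_{p.l}-W^i{}_{l.p}\big)_{.j}$.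 Weakly-Weyl curvature: $\tilde W_j{}^i{}_{kl}=W_j{}^i{}_{pl.k}\,y^p$. $F$ is a weakly-Weyl Finsler metric if $\tilde W_j{}^i{}_{kl}=\omega_{jkl}\,y^i$ for some tensor $\omega_{jkl}=\omega_{jkl}(x,y)$ satisfying $\omega_{jkl|0}+\mu F\omega_{jkl}=0$ for some scalar function $\mu$ on $TM\setminus\{0\}$. Douglas curvature: $D_j{}^i{}_{kl}=\frac{\partial^3}{\partial y^j\partial y^k\partial y^l}\Big(G^i-\frac1{n+1}\frac{\partial G^m}{\partial y^m}y^i\Big)$. $F$ is a GDW-metric (generalized Douglas–Weyl metric) if $D_j{}^i{}_{kl|m}y^m=T_{jkl}\,y^i$ for some tensor $T_{jkl}$. *)

(* Defs.v *)
From HB Require Import structures.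
From mathcomp Require Import all_boot all_order all_algebra.
From mathcomp Require Import all_classical all_reals all_analysis.

Set Implicit Arguments.
Unset Strict Implicit.
Unset Printing Implicit Defensive.

Import Order.TTheory GRing.Theory Num.Theory.
Import numFieldNormedType.Exports.

Local Open Scope classical_set_scope.
Local Open Scope ring_scope.

(* C^k and C^oo on a set A, meant for A open. *)
Fixpoint Ck (R : realType) (V W : normedModType R) (k : nat) (A : set V)
    (f : V -> W) : Prop :=
  (forall x, A x -> {for x, continuous f}) /\
  match k with
  | 0 => True
  | k'.+1 => forall v : V,
      (forall x, A x -> derivable f x v) /\ Ck k' A (fun x => 'D_v f x)
  end.

Definition smooth_on (R : realType) (V W : normedModType R) (A : set V)
    (f : V -> W) : Prop := forall k, Ck k A f.

(* Smooth n-manifolds presented by a smooth atlas.  [phi a] and [psi a] are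
   total functions, relevant only on [dom a] and on [phi a @` dom a]. *)
Record smooth_manifold (R : realType) (n : nat) := SmoothManifold {
  carrier :> topologicalType ;
  chart : Type ;
  dom : chart -> set carrier ;
  phi : chart -> carrier -> 'rV[R]_n ;
  psi : chart -> 'rV[R]_n -> carrier ;
  manifold_hausdorff : hausdorff_space carrier ;
  manifold_countable : @second_countable carrier ;
  dom_cover : forall p, exists a, dom a p ;
  dom_open : forall a, open (dom a) ;
  img_open : forall a, open (phi a @` dom a) ;
  phiK : forall a p, dom a p -> psi a (phi a p) = p ;
  phi_continuous : forall a, {within dom a, continuous (phi a)} ;
  psi_continuous : forall a, {within phi a @` dom a, continuous (psi a)} ;
  transition_smooth : forall a b,
    smooth_on (phi a @` (dom a `&` dom b)) (phi b \o psi a)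
}.

(* A point (x, y) of TM over the domain of a chart is the pair z of row vectors
   z.1 = (x^i), z.2 = (y^i).  A function, or a tensor with components indexed by
   the coordinates, on TM or on TM \ {0}, is the family of its local expressions
   in the charts, subject to the usual transformation rule. *)
Section TangentBundle.
Variables (R : realType) (n : nat) (M : smooth_manifold R n).
Local Notation TV := ('rV[R]_n * 'rV[R]_n)%type.
Implicit Types (a b : chart M) (z : TV).

Definition TMchart a : set TV := [set z | (phi a @` dom a) z.1].

Definition slit a : set TV := [set z | TMchart a z /\ z.2 != 0].

Definition TMoverlap a b : set TV :=
  [set z | (phi a @` (dom a `&` dom b)) z.1].

(* [chart_jac a b z j p] is the derivative of the p-th coordinate of chart b
   with respect to the j-th coordinate of chart a. *)
Definition chart_jac a b z : 'M[R]_n := 'J (phi b \o psi a) z.1.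

Definition TMchange a b z : TV := (phi b (psi a z.1), z.2 *m chart_jac a b z).

Definition scalar_on_TM (f : chart M -> TV -> R) : Prop :=
  forall a b z, TMoverlap a b z -> f b (TMchange a b z) = f a z.

Definition scalar_on_slit (f : chart M -> TV -> R) : Prop :=
  forall a b z, TMoverlap a b z -> z.2 != 0 -> f b (TMchange a b z) = f a z.

Definition tensor_on_slit (T : chart M -> 'I_n -> 'I_n -> 'I_n -> TV -> R) :
    Prop :=
  (forall a j k l, smooth_on (slit a) (T a j k l)) /\
  (forall a b z j k l, TMoverlap a b z -> z.2 != 0 ->
    T a j k l z = \sum_p \sum_q \sum_r
      chart_jac a b z j p * chart_jac a b z k q * chart_jac a b z l r *
      T b p q r (TMchange a b z)).

End TangentBundle.

Section LocalCoordinates.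
Variables (R : realType) (n : nat).
Local Notation TV := ('rV[R]_n * 'rV[R]_n)%type.
Implicit Types (f : TV -> R) (i j k l m p r : 'I_n) (z : TV).

Definition px k f : TV -> R :=
  fun z => 'D_((delta_mx ord0 k : 'rV[R]_n, 0 : 'rV[R]_n) : TV) f z.

Definition py k f : TV -> R :=
  fun z => 'D_((0 : 'rV[R]_n, delta_mx ord0 k : 'rV[R]_n) : TV) f z.

Definition yc i : TV -> R := fun z => z.2 ord0 i.

Definition kron i k : R := (i == k)%:R.

Section Metric.
Variable F : TV -> R.

Definition Fsq : TV -> R := fun z => F z ^+ 2.

Definition fund z : 'M[R]_n := \matrix_(i, j) (2^-1 * py j (py i Fsq) z).

Definition spray i : TV -> R := fun z =>
  4^-1 * \sum_l invmx (fund z) i l *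
    ((\sum_k py l (px k Fsq) z * yc k z) - px l Fsq z).

End Metric.

Section Spray.
(* In 1-1 tensors the upper index comes first; for the tensors written
   T_j^i_kl the arguments are in the order j, i, k, l. *)
Variable G : 'I_n -> TV -> R.

Definition Nconn r m : TV -> R := py m (G r).

Definition Berwald i r m : TV -> R := py m (py r (G i)).

Definition hcov03 (T : 'I_n -> 'I_n -> 'I_n -> TV -> R) j k l m : TV -> R :=
  fun z => px m (T j k l) z
    - \sum_r Nconn r m z * py r (T j k l) z
    - \sum_r Berwald r j m z * T r k l z
    - \sum_r Berwald r k m z * T j r l z
    - \sum_r Berwald r l m z * T j k r z.

Definition hcov13 (T : 'I_n -> 'I_n -> 'I_n -> 'I_n -> TV -> R) j i k l m :
    TV -> R :=
  fun z => px m (T j i k l) z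
    - \sum_r Nconn r m z * py r (T j i k l) z
    + \sum_r Berwald i r m z * T j r k l z
    - \sum_r Berwald r j m z * T r i k l z
    - \sum_r Berwald r k m z * T j i r l z
    - \sum_r Berwald r l m z * T j i k r z.

Definition Riem i k : TV -> R := fun z =>
  2 * px k (G i) z
  - \sum_m px m (py k (G i)) z * yc m z
  + 2 * \sum_m G m z * py m (py k (G i)) z
  - \sum_m py m (G i) z * py k (G m) z.

Definition Rscal : TV -> R := fun z => (n%:R - 1)^-1 * \sum_m Riem m m z.

Definition Aten i k : TV -> R := fun z => Riem i k z - Rscal z * kron i k.

Definition Weyl i k : TV -> R := fun z =>
  Aten i k z - (n%:R + 1)^-1 * (\sum_m py m (Aten m k) z) * yc i z.

Definition Weyl4 j i p l : TV -> R :=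
  py j (fun z => 3^-1 * (py l (Weyl i p) z - py p (Weyl i l) z)).

Definition weaklyWeylCurv j i k l : TV -> R := fun z =>
  \sum_p py k (Weyl4 j i p l) z * yc p z.

Definition Douglas j i k l : TV -> R :=
  py j (py k (py l (fun z =>
    G i z - (n%:R + 1)^-1 * (\sum_m py m (G m) z) * yc i z))).

End Spray.
End LocalCoordinates.

Section Finsler.
Variables (R : realType) (n : nat) (M : smooth_manifold R n).
Local Notation TV := ('rV[R]_n * 'rV[R]_n)%type.

Record finsler_metric (F : chart M -> TV -> R) : Prop := FinslerMetric {
  finsler_scalar : scalar_on_TM F ;
  finsler_ge0 : forall a z, TMchart a z -> 0 <= F a z ;
  finsler_smooth : forall a, smooth_on (slit a) (F a) ;
  finsler_homogeneous : forall a z (c : R), TMchart a z -> 0 < c ->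
    F a (z.1, c *: z.2) = c * F a z ;
  finsler_convex : forall a z (v : 'rV[R]_n), slit a z -> v != 0 ->
    0 < (v *m fund (F a) z *m v^T) ord0 ord0
}.

Definition weakly_Weyl (F : chart M -> TV -> R) : Prop :=
  exists (omega : chart M -> 'I_n -> 'I_n -> 'I_n -> TV -> R)
         (mu : chart M -> TV -> R),
  [/\ tensor_on_slit omega, scalar_on_slit mu,
      forall a z j i k l, slit a z ->
        weaklyWeylCurv (spray (F a)) j i k l z = omega a j k l z * yc i z &
      forall a z j k l, slit a z ->
        (\sum_m hcov03 (spray (F a)) (omega a) j k l m z * yc m z)
        + mu a z * F a z * omega a j k l z = 0].

Definition GDW (F : chart M -> TV -> R) : Prop :=
  exists2 T : chart M -> 'I_n -> 'I_n -> 'I_n -> TV -> R,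
  tensor_on_slit T &
  forall a z j i k l, slit a z ->
    \sum_m hcov13 (spray (F a)) (Douglas (spray (F a))) j i k l m z * yc m z
    = T a j k l z * yc i z.

End Finsler.

(* Main.v *)
Require Import Defs.
From HB Require Import structures.
From mathcomp Require Import all_boot all_order all_algebra.
From mathcomp Require Import all_classical all_reals all_analysis.
From mathcomp Require Import ring lra.

(* Write [S] for the spray, [B] for its Berwald curvature and [|0] for the
   covariant derivative along [S].  Two identities hold for every spray:
   [3 B_j^i_kl|0 = - (R^i_j.k.l + R^i_k.j.l + R^i_l.j.k)] and [R^i_p y^p = 0], so
   that [3 B_j^i_kl|0 = R^i_p.l.j.k y^p].  Tracing them and expanding the
   definitions of the Douglas and Weyl tensors, all Kronecker deltas cancel and
   [D_j^i_kl|0] differs from the weakly-Weyl curvature by a multiple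
   [c_jkl y^i] of [y^i].  If the latter is [omega_jkl y^i], then
   [D_j^i_kl|0 = T_jkl y^i] with [T = omega + c].  Since [c] is not a tensor by
   itself, the transformation rule of [T] is read off that of [D_j^i_kl|0]; it
   follows from the Euler-Lagrange form [S (L_.i) = dL/dx^i], with [L = F^2], of
   the definition of the spray, which shows that [S] does not depend on the chart. *)

(** Two obstacles shape the development. The identities nest many derivatives, and for total
    functions that agree only on an open set every substitution under a derivative would call for a
    neighbourhood argument. The computation is therefore done in a commutative ring with commuting
    derivations, where equals can be replaced anywhere and [ring] closes the goals; [represents]
    carries the result back to functions. Secondly, smoothness is given by iterated directional
    derivatives, without a total differential. Symmetry of second derivatives, the chain rule and
    the Jacobian of a transition map are therefore derived from the mean value theorem: where a
    directional derivative is continuous, increments are controlled uniformly in the base point. The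
    Euler-Lagrange form has a further benefit: no inverse of the fundamental tensor has to be
    differentiated. Homogeneity of the spray and its independence of the chart both follow by
    cancelling the invertible fibre Hessian of [L]. *)

Set Implicit Arguments.
Unset Strict Implicit.
Unset Printing Implicit Defensive.

Import Order.TTheory GRing.Theory Num.Theory.
Import numFieldNormedType.Exports.

Local Open Scope classical_set_scope.
Local Open Scope ring_scope.

(** * Sprays over a ring with commuting derivations *)

(* Models the smooth functions of (x, y) on an open subset of TM: [dx k], [dy k]
   and [yv k] stand for d/dx^k, d/dy^k and y^k. *)
Record jetring (n : nat) := JetRing {
  jet_sort :> comPzRingType ;
  dx : 'I_n -> {additive jet_sort -> jet_sort} ;
  dy : 'I_n -> {additive jet_sort -> jet_sort} ;
  yv : 'I_n -> jet_sort ;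
  dxM : forall k f g, dx k (f * g) = dx k f * g + f * dx k g ;
  dyM : forall k f g, dy k (f * g) = dy k f * g + f * dy k g ;
  dxC : forall j k f, dx j (dx k f) = dx k (dx j f) ;
  dyC : forall j k f, dy j (dy k f) = dy k (dy j f) ;
  dxyC : forall j k f, dx j (dy k f) = dy k (dx j f) ;
  dx_yv : forall k i, dx k (yv i) = 0 ;
  dy_yv : forall k i, dy k (yv i) = (i == k)%:R
}.
Arguments dx {n j0} : rename.
Arguments dy {n j0} : rename.
Arguments yv {n j0} : rename.

Section JetTheory.
Variables (n : nat) (A : jetring n).
Implicit Types (f g c : A) (i j k l m p r : 'I_n).

Definition jconst c := (forall k, dx k c = 0) /\ (forall k, dy k c = 0).

Lemma dx_1 k : dx k (1 : A) = 0.
Proof.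
by apply: (@addrI _ (dx k 1)); rewrite addr0 -[RHS](congr1 (dx k) (mulr1 1)) dxM mulr1 mul1r.
Qed.

Lemma dy_1 k : dy k (1 : A) = 0.
Proof.
by apply: (@addrI _ (dy k 1)); rewrite addr0 -[RHS](congr1 (dy k) (mulr1 1)) dyM mulr1 mul1r.
Qed.

Lemma jconst_nat (m : nat) : jconst m%:R.
Proof. by split=> k; rewrite raddfMn /= ?dx_1 ?dy_1 mul0rn. Qed.

Lemma dyZ k c f : jconst c -> dy k (c * f) = c * dy k f.
Proof. by move=> [_ cy]; rewrite dyM cy mul0r add0r. Qed.

Lemma kron_suml (h : 'I_n -> A) k : \sum_i (i == k)%:R * h i = h k.
Proof.
rewrite (bigD1 k) //= eqxx mul1r big1 ?addr0 // => i /negbTE ->.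
by rewrite mul0r.
Qed.

Lemma kron_sumr (h : 'I_n -> A) k : \sum_i h i * (i == k)%:R = h k.
Proof. by rewrite -[RHS]kron_suml; apply: eq_bigr => i _; rewrite mulrC. Qed.

Lemma kron_sumr' (h : 'I_n -> A) k : \sum_i h i * (k == i)%:R = h k.
Proof. by rewrite -[RHS]kron_sumr; apply: eq_bigr => i _; rewrite eq_sym. Qed.

(** Euler's relation serves as the definition, because a [jetring] has no rescaling of the fibres.
    Integer degrees let vertical derivatives lower the degree without side conditions. *)
Definition homogeneous (d : int) f := \sum_p yv p * dy p f = f *~ d.

Lemma homD d f g : homogeneous d f -> homogeneous d g -> homogeneous d (f + g).
Proof.
rewrite /homogeneous => hf hg; rewrite mulrzDl -hf -hg -big_split.
by apply: eq_bigr => p _; rewrite raddfD mulrDr.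
Qed.

Lemma homN d f : homogeneous d f -> homogeneous d (- f).
Proof.
rewrite /homogeneous => hf; rewrite mulNrz -hf -sumrN.
by apply: eq_bigr => p _; rewrite raddfN mulrN.
Qed.

Lemma homB d f g : homogeneous d f -> homogeneous d g -> homogeneous d (f - g).
Proof. by move=> hf hg; apply: homD => //; apply: homN. Qed.

Lemma hom0 d : homogeneous d 0.
Proof.
by rewrite /homogeneous mul0rz big1 // => p _; rewrite raddf0 mulr0.
Qed.

Lemma hom_sum d (h : 'I_n -> A) : (forall i, homogeneous d (h i)) -> homogeneous d (\sum_i h i).
Proof.
by move=> hh; apply: big_ind => [|? ?|//]; [apply: hom0 | apply: homD].
Qed.

Lemma homM d e f g : homogeneous d f -> homogeneous e g -> homogeneous (d + e) (f * g).
Proof.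
rewrite /homogeneous => hf hg; under eq_bigr do rewrite dyM mulrDr mulrA mulrCA.
rewrite big_split /= -mulr_suml -mulr_sumr hf hg.
by rewrite mulrzAl mulrzAr -mulrzDr.
Qed.

Lemma hom_jconst c : jconst c -> homogeneous 0 c.
Proof.
by move=> [_ cy]; rewrite /homogeneous mulr0z big1 // => p _; rewrite cy mulr0.
Qed.

Lemma hom_yv i : homogeneous 1 (yv i).
Proof. by rewrite /homogeneous mulr1z; under eq_bigr do rewrite dy_yv; exact: kron_sumr'. Qed.

(** Differentiating Euler's relation produces one extra copy of [dy k f], which cancels one of the
    [d + 1] on the right. *)
Lemma hom_dy d f k : homogeneous (d + 1) f -> homogeneous d (dy k f).
Proof.
rewrite /homogeneous => /(congr1 (dy k)); rewrite raddf_sum raddfMz.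
under eq_bigr do rewrite dyM dy_yv dyC.
by rewrite big_split /= kron_suml mulrzDr mulr1z addrC; apply: addIr.
Qed.

Lemma hom_dx d f k : homogeneous d f -> homogeneous d (dx k f).
Proof.
rewrite /homogeneous => /(congr1 (dx k)); rewrite raddf_sum raddfMz => <-.
by apply: eq_bigr => p _; rewrite dxM dx_yv mul0r add0r dxyC.
Qed.

(** * Curvature of an arbitrary spray *)

Section Spray.
Variable (G : 'I_n -> A).

(* [jS] is the derivative along the spray vector field; the other definitions
   prefixed by [j] transcribe those of Defs to a spray with coefficients in [A]. *)
Definition jS f := \sum_m (yv m * dx m f - 2 * (G m * dy m f)).

Lemma jSM f g : jS (f * g) = jS f * g + f * jS g.
Proof.
rewrite /jS mulr_suml mulr_sumr -big_split; apply: eq_bigr => m _ /=.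
by rewrite dxM dyM; ring.
Qed.

Fact jS_additive : additive jS.
Proof.
move=> f g; rewrite /jS -sumrB; apply: eq_bigr => m _.
by rewrite !raddfB /=; ring.
Qed.
HB.instance Definition _ := GRing.isAdditive.Build A A jS jS_additive.

Lemma jSZ c f : jconst c -> jS (c * f) = c * jS f.
Proof.
move=> [cx cy]; rewrite jSM (_ : jS c = 0) ?mul0r ?add0r //.
by rewrite /jS big1 // => m _; rewrite cx cy !mulr0 subrr.
Qed.

Lemma jS_yv i : jS (yv i) = - 2 * G i.
Proof.
rewrite /jS; under eq_bigr do rewrite dx_yv dy_yv mulr0 add0r -mulrN -mulNr.
by rewrite -mulr_sumr kron_sumr' mulNr mulrN.
Qed.

(** The commutator of a vertical derivative with the spray comes only from the coefficients y^m and
    G^m of the latter. *)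
Lemma dyS j f :
  dy j (jS f) = jS (dy j f) + dx j f - 2 * \sum_m dy j (G m) * dy m f.
Proof.
rewrite -[dx j f](kron_suml (fun m => dx m f)) /jS raddf_sum mulr_sumr.
rewrite -big_split -sumrB /=; apply: eq_bigr => m _.
rewrite raddfB /= dyM dy_yv dyZ; last exact: jconst_nat.
by rewrite dyM -dxyC (dyC j m); ring.
Qed.

Definition G1 i j := dy j (G i).
Definition G2 i j k := dy k (G1 i j).
Definition G3 i j k l := dy l (G2 i j k).

Lemma G2C i j k : G2 i j k = G2 i k j. Proof. exact: dyC. Qed.
Lemma G3C12 i j k l : G3 i j k l = G3 i k j l.
Proof. by rewrite /G3 G2C. Qed.
Lemma G3C23 i j k l : G3 i j k l = G3 i j l k. Proof. exact: dyC. Qed.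

(** A tuple of equations, so that a single [rewrite] sorts the lower indices of every [G3]. *)
Lemma G3perm i j k l :
  (((G3 i j l k = G3 i j k l) * (G3 i k j l = G3 i j k l)) *
  ((G3 i k l j = G3 i j k l) * (G3 i l j k = G3 i j k l) *
  (G3 i l k j = G3 i j k l)))%type.
Proof.
split; first by rewrite -G3C23 -G3C12.
split; first split; first by rewrite G3C23 G3C12.
  by rewrite G3C12 G3C23.
by rewrite G3C12 G3C23 G3C12.
Qed.

Definition jRiem i k := 2 * dx k (G i) - \sum_m dx m (dy k (G i)) * yv m
  + 2 * (\sum_m G m * dy m (dy k (G i))) - \sum_m dy m (G i) * dy k (G m).

(** The two middle terms of the definition combine into a derivative along the spray, so that [dyS]
    governs all vertical derivatives of the curvature. *)
Lemma jRiemE i k :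
  jRiem i k = 2 * dx k (G i) - jS (G1 i k) - \sum_m G1 i m * G1 m k.
Proof.
rewrite /jRiem; have -> : jS (G1 i k) = \sum_m dx m (dy k (G i)) * yv m
   - 2 * \sum_m G m * dy m (dy k (G i)).
  by rewrite mulr_sumr -sumrB; apply: eq_bigr => m _; rewrite /G1; ring.
by rewrite /G1; ring.
Qed.

Lemma dydyRiem i j k l :
  dy l (dy j (jRiem i k)) =
   2 * dx k (G2 i j l) - dx l (G2 i k j) - dx j (G2 i k l) - jS (G3 i k j l)
   + \sum_m (2 * (G1 m l * G3 i k j m) + 2 * (G2 m j l * G2 i k m)
             + 2 * (G1 m j * G3 i k m l) - G3 i m j l * G1 m k
             - G2 i m j * G2 m k l - G2 i m l * G2 m k j - G1 i m * G3 m k j l).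
Proof.
have E1 : dy j (jRiem i k) = 2 * dx k (G1 i j) - jS (G2 i k j) - dx j (G1 i k)
    + \sum_m (2 * (G1 m j * G2 i k m) - G2 i m j * G1 m k - G1 i m * G2 m k j).
  rewrite jRiemE !raddfB /= dyZ ?dyS; last exact: jconst_nat.
  rewrite -dxyC raddf_sum /= !sumrB -mulr_sumr.
  rewrite -/(G1 i j) -/(G2 i k j).
  under [X in _ - _ - X = _]eq_bigr do rewrite dyM.
  by rewrite big_split /= -/(G1 _ _) /G2 /G1; ring.
rewrite E1 raddfD !raddfB /= dyZ ?dyS; last exact: jconst_nat.
rewrite -!dxyC raddf_sum /= -/(G2 i j l) -/(G2 i k l) -/(G3 i k j l).
have -> : \sum_i0 dy l (2 * (G1 i0 j * G2 i k i0) - G2 i i0 j * G1 i0 k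
             - G1 i i0 * G2 i0 k j) =
   \sum_m (2 * (G2 m j l * G2 i k m)
             + 2 * (G1 m j * G3 i k m l) - G3 i m j l * G1 m k
             - G2 i m j * G2 m k l - G2 i m l * G2 m k j - G1 i m * G3 m k j l).
  apply: eq_bigr => m _; rewrite !raddfB /= dyZ; last exact: jconst_nat.
  by rewrite !dyM /G3 /G2; ring.
have -> : \sum_m dy l (G m) * dy m (G2 i k j) = \sum_m G1 m l * G3 i k j m by [].
rewrite opprB addrA mulr_sumr.
rewrite (_ : \sum_m (2 * (G1 m l * G3 i k j m) + _ + _ - _ - _ - _ - _) =
  \sum_m 2 * (G1 m l * G3 i k j m) + \sum_m (2 * (G2 m j l * G2 i k m)
             + 2 * (G1 m j * G3 i k m l) - G3 i m j l * G1 m k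
             - G2 i m j * G2 m k l - G2 i m l * G2 m k j - G1 i m * G3 m k j l)).
  by ring.
by rewrite -big_split; apply: eq_bigr => m _ /=; ring.
Qed.

(** This is the horizontal derivative already contracted with y: for a spray of degree 2, y^m G^i_rm
    = N^i_r, so the connection coefficients reduce to [G1] (see [sum_jhcov13]). *)
Definition nab13 (T : 'I_n -> 'I_n -> 'I_n -> 'I_n -> A) j i k l :=
  jS (T j i k l) + \sum_r (G1 i r * T j r k l - G1 r j * T r i k l
    - G1 r k * T j i r l - G1 r l * T j i k r).

Definition jB j i k l := G3 i j k l.

(** Let each of [j], [k], [l] in turn be the curvature index in [dydyRiem]. The terms [dx (G2)]
    cancel with weights 2 - 1 - 1, each turn leaves one [- jS (G3)], whence the factor 3, and the
    quadratic sums cancel summand by summand. *)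
Lemma nab_Berwald j i k l : 3 * nab13 jB j i k l =
  - (dy l (dy k (jRiem i j)) + dy l (dy j (jRiem i k)) + dy k (dy j (jRiem i l))).
Proof.
rewrite !dydyRiem /nab13 /jB.
rewrite (G2C i k j) (G2C i l j) (G2C i l k).
rewrite !(G3perm i j k l).
set s1 := \sum_r _; set s2 := \sum_m _; set s3 := \sum_m _; set s4 := \sum_m _.
have : 3 * s1 + s2 + s3 + s4 = 0.
  rewrite /s1 /s2 /s3 /s4 mulr_sumr -!big_split big1 //= => m _.
  rewrite !(G3perm i j k m) !(G3perm i j l m) !(G3perm i k l m) !(G3perm m j k l).
  rewrite !(G2C i m) !(G2C m k j) !(G2C m l j) !(G2C m l k).
  by ring.
move=> h; transitivity (3 * jS (G3 i j k l) + (3 * s1 + s2 + s3 + s4) - s2 - s3 - s4).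
  by ring.
by rewrite h; ring.
Qed.

(** * Homogeneous sprays: Weyl and Douglas tensors *)

Section Homogeneous.
Hypothesis homG : forall i, homogeneous 2 (G i).

Lemma hom_G1 i k : homogeneous 1 (G1 i k). Proof. exact: (hom_dy (d := 1)) (homG i). Qed.

Lemma G1_yv i : \sum_m yv m * G1 i m = 2 * G i.
Proof. by rewrite (homG i : _ = _) mulr_natl. Qed.

Lemma G2_yv i r : \sum_m yv m * G2 i r m = G1 i r.
Proof. by rewrite (hom_G1 i r : _ = _). Qed.

Lemma hom_S d f : homogeneous d f -> homogeneous (d + 1) (jS f).
Proof.
move=> hf; apply: hom_sum => m; apply: homB.
  by rewrite addrC; apply: homM (hom_yv m) (hom_dx m hf).
rewrite -[d + 1]add0r; apply: homM; first exact/hom_jconst/jconst_nat.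
rewrite (_ : d + 1 = 2 + (d - 1)); last by ring.
by apply: homM => //; apply: hom_dy; rewrite subrK.
Qed.

Lemma hom_Riem i k : homogeneous 2 (jRiem i k).
Proof.
rewrite jRiemE; apply: homB; first apply: homB.
- by rewrite -[2]add0r; apply: homM; [exact/hom_jconst/jconst_nat | exact: hom_dx].
- exact: hom_S (hom_G1 _ _).
- by apply: hom_sum => m; apply: (homM (hom_G1 _ _) (hom_G1 _ _)).
Qed.

(** Apply Leibniz to S (y^p N^i_p) = S (2 G^i) with S (y^p) = - 2 G^p. The terms in S (G^i) cancel,
    and what remains is a balance of products G^p N^i_p. *)
Lemma Riem_yv i : \sum_p yv p * jRiem i p = 0.
Proof.
transitivity (2 * (\sum_p (yv p * dx p (G i) - 2 * (G p * G1 i p)))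
  - jS (\sum_p yv p * G1 i p) + \sum_p (jS (yv p) * G1 i p + 4 * (G p * G1 i p)
     - yv p * \sum_m G1 i m * G1 m p)).
  rewrite [jS _]raddf_sum mulr_sumr -sumrB -big_split; apply: eq_bigr => p _ /=.
  by rewrite jRiemE jSM; ring.
rewrite G1_yv jSZ; last exact: jconst_nat.
rewrite subrr add0r; transitivity (\sum_p 2 * (G1 i p * G p) -
    \sum_p \sum_m G1 i m * (yv p * G1 m p)).
  rewrite -sumrB; apply: eq_bigr => p _; rewrite jS_yv.
  rewrite (_ : \sum_m G1 i m * (yv p * G1 m p) = yv p * \sum_m G1 i m * G1 m p).
    by ring.
  by rewrite mulr_sumr; apply: eq_bigr => m _; ring.
rewrite exchange_big -sumrB big1 //= => p _.
by rewrite -mulr_sumr G1_yv; ring.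
Qed.

Lemma sum_yv_dy3 (h : 'I_n -> A) j k l :
  dy k (dy j (dy l (\sum_p yv p * h p))) =
  \sum_p yv p * dy k (dy j (dy l (h p)))
  + dy j (dy k (h l)) + dy l (dy k (h j)) + dy l (dy j (h k)).
Proof.
have dyS (g : 'I_n -> A) q : dy q (\sum_p yv p * g p) = g q + \sum_p yv p * dy q (g p).
  rewrite raddf_sum; under eq_bigr do rewrite dyM dy_yv.
  by rewrite big_split /= kron_suml.
rewrite dyS raddfD /= dyS !raddfD /= dyS.
by rewrite (dyC k l) (dyC k j) (dyC j l); ring.
Qed.

(** Take three vertical derivatives of [Riem_yv]: the terms in which one of them hits y^p are
    exactly those of [nab_Berwald], with the opposite sign. *)
Lemma nab_Berwald_Riem j i k l :
  3 * nab13 jB j i k l = \sum_p yv p * dy k (dy j (dy l (jRiem i p))).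
Proof.
have := sum_yv_dy3 (jRiem i) j k l; rewrite Riem_yv !raddf0 nab_Berwald => /eqP.
rewrite eq_sym -!addrA addr_eq0 => /eqP ->; congr (- _).
by rewrite (dyC j k); ring.
Qed.

(** Second vertical derivatives of an element of degree 2 have degree 0, so the Euler operator kills
    them. *)
Lemma sum_yv_dy2_hom2 f j k : homogeneous 2 f -> \sum_p yv p * dy k (dy j (dy p f)) = 0.
Proof.
move=> hf; transitivity (\sum_p yv p * dy p (dy k (dy j f))).
  by apply: eq_bigr => p _; rewrite (dyC j) (dyC k).
by apply: (@hom_dy 0 _ k (@hom_dy 1 _ j hf)).
Qed.

(* [c1], [c2], [t3] stand for 1/(n-1), 1/(n+1), 1/3. *)
Variables (c1 c2 t3 : A).
Hypotheses (hc1 : jconst c1) (hc2 : jconst c2) (ht3 : jconst t3).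

Definition jRs := c1 * \sum_m jRiem m m.
Definition jA i k := jRiem i k - jRs * (i == k)%:R.
Definition jWeyl i k := jA i k - c2 * (\sum_m dy m (jA m k)) * yv i.
Definition jWeyl4 j i p l := dy j (t3 * (dy l (jWeyl i p) - dy p (jWeyl i l))).
Definition jWW j i k l := \sum_p dy k (jWeyl4 j i p l) * yv p.
Definition jDoug j i k l :=
  dy j (dy k (dy l (G i - c2 * (\sum_m dy m (G m)) * yv i))).

Definition jdivA k := \sum_m dy m (jA m k).
Definition jdivN := \sum_m G1 m m.
Definition nab02 (T : 'I_n -> 'I_n -> A) j k :=
  jS (T j k) - \sum_r (G1 r j * T r k + G1 r k * T j r).
Definition nab03 (T : 'I_n -> 'I_n -> 'I_n -> A) j k l :=
  jS (T j k l) - \sum_r (G1 r j * T r k l + G1 r k * T j r l + G1 r l * T j k r).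

Lemma hom_Rs : homogeneous 2 jRs.
Proof.
rewrite -[2]add0r; apply: homM; first exact: hom_jconst.
by apply: hom_sum => m; apply: hom_Riem.
Qed.

Lemma hom_kron i k : homogeneous 0 ((i == k)%:R : A).
Proof. exact/hom_jconst/jconst_nat. Qed.

Lemma hom_A i k : homogeneous 2 (jA i k).
Proof.
apply: homB; first exact: hom_Riem.
by rewrite -[2]addr0; apply: homM hom_Rs (hom_kron _ _).
Qed.

Lemma hom_divA k : homogeneous 1 (jdivA k).
Proof. by apply: hom_sum => m; apply: (hom_dy (d := 1)) (hom_A _ _). Qed.

Lemma hom_Weyl i k : homogeneous 2 (jWeyl i k).
Proof.
apply: homB; first exact: hom_A.
rewrite -[2]/(0 + 1 + 1); apply: homM; last exact: hom_yv.
by apply: homM (hom_divA _); exact: hom_jconst.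
Qed.

(** Of the two antisymmetrized halves of [jWeyl4], the one differentiated in the contracted index
    vanishes by [sum_yv_dy2_hom2]. *)
Lemma jWW_E j i k l :
  jWW j i k l = t3 * \sum_p yv p * dy k (dy j (dy l (jWeyl i p))).
Proof.
transitivity (t3 * (\sum_p yv p * dy k (dy j (dy l (jWeyl i p)))
    - \sum_p yv p * dy k (dy j (dy p (jWeyl i l))))); last first.
  by rewrite (sum_yv_dy2_hom2 _ _ (hom_Weyl i l)) subr0.
rewrite -sumrB mulr_sumr; apply: eq_bigr => p _.
by rewrite /jWeyl4 dyZ // dyZ // !raddfB /=; ring.
Qed.

Lemma dy_kronM i k j f : dy j (f * (i == k)%:R) = dy j f * (i == k)%:R.
Proof. by rewrite mulrC dyZ 1?mulrC //; exact: jconst_nat. Qed.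

Lemma dy3_mul_yv f i j k l : dy j (dy k (dy l (f * yv i))) =
  dy j (dy k (dy l f)) * yv i + dy k (dy l f) * (i == j)%:R
  + dy j (dy l f) * (i == k)%:R + dy j (dy k f) * (i == l)%:R.
Proof.
rewrite dyM dy_yv raddfD /= dyM dy_yv dy_kronM !raddfD /= dyM dy_yv !dy_kronM.
by ring.
Qed.

(** The factor c_jkl of the overview. Its terms come from the three sources of y^i: the part R
    delta^i_p contracted with y^p, the trace correction in [jWeyl], and the trace correction in
    [jDoug]. *)
Definition jcorr j k l := t3 * (dy j (dy k (dy l jRs)) +
  c2 * \sum_p yv p * dy j (dy k (dy l (jdivA p))))
  - c2 * nab03 (fun j k l => dy j (dy k (dy l jdivN))) j k l.

Lemma jDougE j i k l : jDoug j i k l = jB j i k l - c2 *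
  (dy j (dy k (dy l jdivN)) * yv i + dy k (dy l jdivN) * (i == j)%:R
  + dy j (dy l jdivN) * (i == k)%:R + dy j (dy k jdivN) * (i == l)%:R).
Proof.
rewrite /jDoug !raddfB /= -mulrA 3?(dyZ _ _ hc2) dy3_mul_yv; congr (_ - _).
by rewrite -[LHS]/(G3 i l k j) /jB !(G3perm i j k l).
Qed.

(** Covariant differentiation along the spray is a derivation for which y^i and the Kronecker delta
    are parallel: S (y^i) + N^i_r y^r = - 2 G^i + 2 G^i = 0, and the two connection terms of delta
    cancel. Only the derivatives of [jdivN] get differentiated. *)
Lemma nab_Doug j i k l : nab13 jDoug j i k l = nab13 jB j i k l
  - c2 * (nab03 (fun j k l => dy j (dy k (dy l jdivN))) j k l * yv i
  + nab02 (fun j k => dy j (dy k jdivN)) k l * (i == j)%:R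
  + nab02 (fun j k => dy j (dy k jdivN)) j l * (i == k)%:R
  + nab02 (fun j k => dy j (dy k jdivN)) j k * (i == l)%:R).
Proof.
have jSkron f a b : jS (f * (a == b)%:R) = jS f * (a == b)%:R.
  by rewrite mulrC jSZ 1?mulrC //; exact: jconst_nat.
set P2 := fun j k => dy j (dy k jdivN).
set P3 := fun j k l => dy j (dy k (dy l jdivN)).
have E j' i' k' l' : jDoug j' i' k' l' = jB j' i' k' l' - c2 *
  (P3 j' k' l' * yv i' + P2 k' l' * (i' == j')%:R + P2 j' l' * (i' == k')%:R
   + P2 j' k' * (i' == l')%:R) by exact: jDougE.
rewrite /nab13 !E raddfB /= jSZ // !raddfD /= !jSkron jSM jS_yv.
set s := (X in _ + X = _); set t := \sum_r _.
have -> : s = t - c2 * \sum_r (P3 j k l * (yv r * G1 i r)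
    + P2 k l * (G1 i r * (r == j)%:R) + P2 j l * (G1 i r * (r == k)%:R)
    + P2 j k * (G1 i r * (r == l)%:R)
    - (G1 r j * P3 r k l + G1 r k * P3 j r l + G1 r l * P3 j k r) * yv i
    - P2 k l * (G1 r j * (i == r)%:R) - P2 j l * (G1 r k * (i == r)%:R)
    - P2 j k * (G1 r l * (i == r)%:R)
    - (G1 r k * P2 r l + G1 r l * P2 k r) * (i == j)%:R
    - (G1 r j * P2 r l + G1 r l * P2 j r) * (i == k)%:R
    - (G1 r j * P2 r k + G1 r k * P2 j r) * (i == l)%:R).
  by rewrite /s /t mulr_sumr -sumrB; apply: eq_bigr => r _; rewrite !E; ring.
rewrite !sumrB !big_split /= -!mulr_sumr -!mulr_suml G1_yv.
rewrite !kron_sumr.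
rewrite !(kron_sumr' (fun r => G1 r _)).
by rewrite /nab03 /nab02 -/P2 -/P3 !big_split /=; ring.
Qed.


Lemma dydy_divN j k : dy j (dy k jdivN) = \sum_m jB m m j k.
Proof. by rewrite !raddf_sum; apply: eq_bigr => m _; exact: G3C23. Qed.

(** Covariant differentiation commutes with the trace: the connection terms of the two contracted
    indices cancel once the sums are exchanged. *)
Lemma nab02_divN j k :
  nab02 (fun j k => dy j (dy k jdivN)) j k = \sum_m nab13 jB m m j k.
Proof.
rewrite /nab13 big_split -raddf_sum /nab02 dydy_divN; congr (_ + _).
under [RHS]eq_bigr do rewrite !sumrB.
rewrite !sumrB [X in X - _ - _ - _]exchange_big /= subrr sub0r.
rewrite big_split opprD /=; congr (- _ - _); rewrite exchange_big;
  by apply: eq_bigr => r _; rewrite dydy_divN mulr_sumr.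
Qed.

(** Trace of [nab_Berwald_Riem]. Replacing [jRiem] by [jA] costs a vertical derivative of [jRs],
    which has degree 2 and so contributes nothing after contraction with y. This is the relation
    that makes the Kronecker terms of the Douglas and Weyl sides agree. *)
Lemma nab02_divN_divA j k : 3 * nab02 (fun j k => dy j (dy k jdivN)) j k =
  \sum_p yv p * dy k (dy j (jdivA p)).
Proof.
rewrite nab02_divN mulr_sumr; under eq_bigr do rewrite nab_Berwald_Riem.
rewrite exchange_big; transitivity (\sum_p yv p * dy k (dy j (jdivA p)) +
    \sum_p yv p * dy k (dy j (dy p jRs))); last first.
  by rewrite (sum_yv_dy2_hom2 _ _ hom_Rs) addr0.
rewrite -big_split; apply: eq_bigr => p _ /=.
rewrite -mulrDr -mulr_sumr -!raddfD; congr (_ * _).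
rewrite /jdivA; under [in RHS]eq_bigr do rewrite raddfB /= dy_kronM.
rewrite sumrB kron_sumr subrK !raddf_sum; apply: eq_bigr => m _.
by rewrite (dyC m k) (dyC j k).
Qed.

Definition jhcov13 (T : 'I_n -> 'I_n -> 'I_n -> 'I_n -> A) j i k l m :=
  dx m (T j i k l)
    - \sum_r dy m (G r) * dy r (T j i k l)
    + \sum_r dy m (dy r (G i)) * T j r k l
    - \sum_r dy m (dy j (G r)) * T r i k l
    - \sum_r dy m (dy k (G r)) * T j i r l
    - \sum_r dy m (dy l (G r)) * T j i k r.

Lemma sum_jhcov13 T j i k l :
  \sum_m jhcov13 T j i k l m * yv m = nab13 T j i k l.
Proof.
have swap (a : 'I_n -> 'I_n -> A) (b c : 'I_n -> A) :
    (forall r, \sum_m yv m * a r m = c r) ->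
    \sum_m (\sum_r a r m * b r) * yv m = \sum_r c r * b r.
  move=> h; under eq_bigr do rewrite mulr_suml.
  rewrite exchange_big; apply: eq_bigr => r _.
  by rewrite -h mulr_suml; apply: eq_bigr => m _; ring.
rewrite /jhcov13; under eq_bigr do rewrite !mulrDl !mulNr.
rewrite !big_split /= !sumrN /nab13 !sumrB.
rewrite (swap _ _ _ G1_yv) (swap _ _ _ (G2_yv i)) (swap _ _ _ (G2_yv^~ j)).
rewrite (swap _ _ _ (G2_yv^~ k)) (swap _ _ _ (G2_yv^~ l)) !addrA /jS sumrB.
congr (_ - _ + _ - _ - _ - _); first by apply: eq_bigr => m _; rewrite mulrC.
by apply: eq_bigr => m _; ring.
Qed.

Hypothesis t3K : 3 * t3 = 1.

(** On both sides the Kronecker deltas are multiplied by contractions of second derivatives of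
    [jdivA], with the same factor [t3 * c2]; all other corrections are multiples of [yv i]. *)
Theorem nab_Doug_weaklyWeyl j i k l :
  nab13 jDoug j i k l = jWW j i k l + jcorr j k l * yv i.
Proof.
have h3 a b : 3 * a = b -> a = t3 * b by move=> <-; rewrite mulrA (mulrC t3) t3K mul1r.
rewrite nab_Doug (h3 _ _ (nab_Berwald_Riem _ _ _ _)) jWW_E /jcorr.
rewrite !(h3 _ _ (nab02_divN_divA _ _)).
have dy3Weyl p : dy k (dy j (dy l (jWeyl i p))) =
    dy k (dy j (dy l (jRiem i p))) - dy k (dy j (dy l jRs)) * (i == p)%:R
    - c2 * (dy k (dy j (dy l (jdivA p))) * yv i
       + dy j (dy l (jdivA p)) * (i == k)%:R
       + dy k (dy l (jdivA p)) * (i == j)%:R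
       + dy k (dy j (jdivA p)) * (i == l)%:R).
  by rewrite /jWeyl !raddfB /= !dy_kronM -mulrA !(dyZ _ _ hc2) dy3_mul_yv.
have -> : \sum_p yv p * dy k (dy j (dy l (jWeyl i p))) =
  \sum_p yv p * dy k (dy j (dy l (jRiem i p)))
  - (\sum_p yv p * (i == p)%:R) * dy j (dy k (dy l jRs))
  - c2 * ((\sum_p yv p * dy j (dy k (dy l (jdivA p)))) * yv i
    + (\sum_p yv p * dy l (dy k (jdivA p))) * (i == j)%:R
    + (\sum_p yv p * dy l (dy j (jdivA p))) * (i == k)%:R
    + (\sum_p yv p * dy k (dy j (jdivA p))) * (i == l)%:R).
  rewrite !mulr_suml -!big_split mulr_sumr -!sumrB; apply: eq_bigr => p _ /=.
  rewrite dy3Weyl !(dyC k j (dy l _)) (dyC l k (jdivA p)) (dyC l j (jdivA p)).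
  ring.
by rewrite kron_sumr'; ring.
Qed.
End Homogeneous.

(** * Homogeneity of an Euler-Lagrange spray *)

Section EulerLagrange.
Variables (L : A) (h : 'I_n -> 'I_n -> A).
Hypothesis homL : homogeneous 2 L.
Hypothesis EL : forall i, jS (dy i L) = dx i L.
Hypothesis hK : forall k l, \sum_i h k i * dy l (dy i L) = (k == l)%:R.
Variable h2 : A.
Hypothesis h2K : h2 * 2 = 1.

(** The Euler-Lagrange equation expresses the product of the Hessian of [L] with 2 G through
    derivatives of [L], hence as an element of degree 2. Since the Hessian has degree 0, it
    annihilates the Euler defect [u] of G, and it is invertible. *)
Lemma euler_lagrange_hom i : homogeneous 2 (G i).
Proof.
pose u l := \sum_p yv p * dy p (G l) - 2 * G l.
suff u0 : u i = 0.
  by apply/eqP; rewrite -subr_eq0; apply/eqP; rewrite -[RHS]u0 /u mulr_natl.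
have E q : \sum_l dy l (dy q L) * (2 * G l) =
    \sum_m yv m * dx m (dy q L) - dx q L.
  rewrite -EL /jS sumrB opprB addrC subrK.
  by apply: eq_bigr => l _; ring.
have hE q : homogeneous 2 (\sum_l dy l (dy q L) * (2 * G l)).
  rewrite E; apply: homB; last exact: hom_dx.
  apply: hom_sum => m; apply: (homM (hom_yv m) (e := 1)).
  exact/hom_dx/(hom_dy (d := 1)).
have uE q : \sum_l dy l (dy q L) * u l = 0.
  rewrite -[LHS]mul1r -h2K -mulrA.
  suff -> : 2 * \sum_l dy l (dy q L) * u l = 0 by rewrite mulr0.
  (* The Euler operator passes through the Hessian, so this Euler defect of a degree 2 element is
     twice the Hessian applied to [u]. *)
  transitivity (\sum_p yv p * dy p (\sum_l dy l (dy q L) * (2 * G l)) -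
      2 * \sum_l dy l (dy q L) * (2 * G l)); last first.
    by rewrite mulr_natl (hE q : _ = _) subrr.
  under [X in _ = X - _]eq_bigr do rewrite raddf_sum mulr_sumr.
  rewrite exchange_big !mulr_sumr -sumrB; apply: eq_bigr => l _ /=.
  transitivity (\sum_p yv p * dy p (dy l (dy q L)) * (2 * G l) +
      \sum_p dy l (dy q L) * 2 * (yv p * dy p (G l)) -
      2 * (dy l (dy q L) * (2 * G l))).
    rewrite -mulr_suml (hom_dy (d := 0) l (hom_dy (d := 1) q homL) : _ = 0).
    by rewrite /u -mulr_sumr; ring.
  rewrite -big_split; congr (_ - _); apply: eq_bigr => p _ /=.
  by rewrite dyM dyZ; [ring | exact: jconst_nat].
rewrite -[LHS](kron_sumr' u i).
under eq_bigr do rewrite -hK mulr_sumr.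
rewrite exchange_big big1 //= => q _.
rewrite -[RHS](mulr0 (h i q)) -[in RHS](uE q) mulr_sumr.
by apply: eq_bigr => l _; ring.
Qed.
End EulerLagrange.
End Spray.
End JetTheory.

(** * Change of coordinates *)

Section ChangeOfCoordinates.
(** [p] models the pullback along the change of charts (x, y) -> (x', y J), and [K] the inverse
    Jacobian. [p_dy] and [p_dx] are the chain rule; the second sum of [p_dx] arises because y J
    depends on x. *)
Variables (n : nat) (A B : jetring n) (p : {rmorphism B -> A}).
Variables (J K : 'I_n -> 'I_n -> A).
Hypothesis dy_J : forall k j q, dy k (J j q) = 0.
Hypothesis dx_JC : forall k j q, dx k (J j q) = dx j (J k q).
Hypothesis JK : forall j k, \sum_q J j q * K q k = (j == k)%:R.
Hypothesis KJ : forall q r, \sum_j K q j * J j r = (q == r)%:R.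
Hypothesis p_yv : forall q, p (yv q) = \sum_j yv j * J j q.
Hypothesis p_dy : forall k f, dy k (p f) = \sum_q J k q * p (dy q f).
Hypothesis p_dx : forall k f, dx k (p f) =
  \sum_q J k q * p (dx q f) + \sum_q (\sum_r yv r * dx k (J r q)) * p (dy q f).

(** The derivative of the Jacobian along the spray ([jS_J]). *)
Definition Jdot k q : A := \sum_r yv r * dx r (J k q).

Lemma JdotE k q : \sum_r yv r * dx k (J r q) = Jdot k q.
Proof. by apply: eq_bigr => r _; rewrite dx_JC. Qed.

Lemma J_inj (u : 'I_n -> A) :
  (forall i, \sum_q J i q * u q = 0) -> forall q, u q = 0.
Proof.
move=> h q; rewrite -[LHS](kron_sumr' u q).
under eq_bigr do rewrite -KJ mulr_sumr.
rewrite exchange_big big1 //= => j _.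
rewrite -[RHS](mulr0 (K q j)) -[in RHS](h j) mulr_sumr.
by apply: eq_bigr => r _; ring.
Qed.

Variables (G : 'I_n -> A) (G' : 'I_n -> B).
Variables (L : B) (h : 'I_n -> 'I_n -> B).
Hypothesis ELA : forall i, jS G (dy i (p L)) = dx i (p L).
Hypothesis ELB : forall i, jS G' (dy i L) = dx i L.
Hypothesis hK : forall k l, \sum_i h k i * dy l (dy i L) = (k == l)%:R.

Lemma jS_J k q : jS G (J k q) = Jdot k q.
Proof.
by apply: eq_bigr => m _; rewrite dy_J mulr0 mulr0 subr0.
Qed.

(** This is S (p (y'^q)), the vertical component of the spray of the first chart in the coordinates
    of the second. *)
Let V q := \sum_k yv k * Jdot k q - 2 * \sum_k G k * J k q.

Let jS_p_V f : jS G (p f) =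
  \sum_q (p (yv q) * p (dx q f) + V q * p (dy q f)).
Proof.
rewrite /jS.
transitivity (\sum_m \sum_q (yv m * J m q * p (dx q f) +
   (yv m * Jdot m q - 2 * (G m * J m q)) * p (dy q f))).
  apply: eq_bigr => m _; rewrite p_dx p_dy.
  under [X in _ * (_ + X)]eq_bigr do rewrite JdotE.
  rewrite mulrDr !mulr_sumr -big_split -sumrB.
  by apply: eq_bigr => q _ /=; ring.
rewrite exchange_big; apply: eq_bigr => q _ /=.
rewrite big_split -!mulr_suml /= -p_yv; congr (_ + _ * _).
by rewrite sumrB -mulr_sumr.
Qed.

(* Both sprays satisfy the Euler-Lagrange equation of the same [L]: subtract the
   two equations, then cancel the Jacobian and the fibre Hessian of [L]. *)
Let V_eq q : V q = - 2 * p (G' q).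
Proof.
(* Both sides have the same part in [dx], so their difference is the fibre Hessian of [L] applied to
   V + 2 G', and the Hessian can be cancelled. *)
suff h0 q' : jS G (p (dy q' L)) = p (jS G' (dy q' L)).
  have {}h0 q' : \sum_r p (dy r (dy q' L)) * (V r + 2 * p (G' r)) = 0.
    rewrite -[RHS](subrr (jS G (p (dy q' L)))) {2}h0 jS_p_V /jS rmorph_sum -sumrB.
    by apply: eq_bigr => r _; rewrite rmorphB !rmorphM rmorph_nat; ring.
  suff : V q + 2 * p (G' q) = 0 by move/eqP; rewrite addr_eq0 mulNr => /eqP.
  rewrite -[LHS](kron_sumr' (fun q => V q + 2 * p (G' q)) q).
  under eq_bigr => r _.
    rewrite (_ : (q == r)%:R = p ((q == r)%:R)); last by rewrite rmorph_nat.
    rewrite -hK rmorph_sum mulr_sumr; over.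
  rewrite exchange_big big1 //= => j _.
  rewrite -[RHS](mulr0 (p (h q j))) -[in RHS](h0 j) mulr_sumr.
  by apply: eq_bigr => r _; rewrite rmorphM; ring.
(* In the Euler-Lagrange equation of [p L], differentiating the Jacobian in S (J p (L_.q)) gives the
   same [Jdot] term as the chain rule for [dx i (p L)]; what is left is J times the claim. *)
apply/eqP; rewrite -subr_eq0; apply/eqP; move: q'; apply: J_inj => i.
rewrite -[RHS](subrr (dx i (p L))) -{1}ELA p_dy p_dx raddf_sum -big_split -sumrB /=.
by apply: eq_bigr => r _; rewrite jSM jS_J JdotE ELB; ring.
Qed.

Lemma jS_p f : jS G (p f) = p (jS G' f).
Proof.
rewrite jS_p_V /jS rmorph_sum; apply: eq_bigr => q _.
by rewrite V_eq rmorphB !rmorphM rmorph_nat; ring.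
Qed.

Variable h2 : A.
Hypothesis (h2K : h2 * 2 = 1) (h2c : jconst h2).

Lemma spray_change q :
  p (G' q) = \sum_i G i * J i q - h2 * \sum_k yv k * Jdot k q.
Proof.
have : h2 * V q = h2 * (- 2 * p (G' q)) by rewrite V_eq.
rewrite mulrA mulrN h2K mulN1r /V mulrBr mulrA h2K mul1r => /eqP.
by rewrite eq_sym eqr_oppLR opprB => /eqP.
Qed.

Lemma dy_Jdot k j q : dy k (Jdot j q) = dx k (J j q).
Proof.
rewrite /Jdot raddf_sum; under eq_bigr do rewrite dyM dy_yv -dxyC dy_J raddf0 mulr0 addr0.
exact: kron_suml.
Qed.

Lemma dy_yJdot j q : dy j (\sum_k yv k * Jdot k q) = 2 * Jdot j q.
Proof.
rewrite raddf_sum; under eq_bigr do rewrite dyM dy_yv dy_Jdot.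
by rewrite big_split /= kron_suml JdotE; ring.
Qed.

Lemma N_change k r : \sum_q J k q * p (G1 G' r q) =
  \sum_i G1 G i k * J i r - Jdot k r.
Proof.
rewrite -p_dy spray_change raddfB /= dyZ // dy_yJdot mulrA h2K mul1r raddf_sum.
by congr (_ - _); apply: eq_bigr => i _; rewrite dyM dy_J mulr0 addr0.
Qed.

(** Differentiate K J = 1, where J does not depend on y. *)
Lemma dy_K k q j : dy k (K q j) = 0.
Proof.
rewrite -[K q j](kron_sumr (K q)).
transitivity (\sum_i dy k (K q i) * (i == j)%:R).
  rewrite raddf_sum; apply: eq_bigr => i _.
  by rewrite mulrC dyZ 1?mulrC //; exact: jconst_nat.
under eq_bigr do rewrite -JK mulr_sumr.
rewrite exchange_big big1 //= => r _.
transitivity ((dy k (\sum_i K q i * J i r)) * K r j).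
  rewrite raddf_sum mulr_suml; apply: eq_bigr => i _.
  by rewrite dyM dy_J; ring.
by rewrite KJ (jconst_nat _ _).2 mul0r.
Qed.

(** The derivative of log |det J| along the spray. It is linear in y, whence [dydy_trKJ]. *)
Definition trKJ := \sum_k \sum_q K q k * Jdot k q.

Lemma divN_change : p (jdivN G') = jdivN G - trKJ.
Proof.
have E r : p (G1 G' r r) = \sum_k K r k * (\sum_i G1 G i k * J i r - Jdot k r).
  under eq_bigr do rewrite -N_change mulr_sumr.
  rewrite exchange_big -[LHS](kron_sumr' (fun s => p (G1 G' r s)) r).
  apply: eq_bigr => s _ /=; rewrite -KJ mulr_sumr.
  by apply: eq_bigr => j _; ring.
rewrite rmorph_sum; under eq_bigr do rewrite E.
rewrite exchange_big /trKJ /jdivN -sumrB; apply: eq_bigr => k _ /=.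
under eq_bigr do rewrite mulrBr mulr_sumr.
rewrite sumrB exchange_big; congr (_ - _).
rewrite -[RHS](kron_sumr (fun i => G1 G i k) k); apply: eq_bigr => i _ /=.
by rewrite -JK mulr_sumr; apply: eq_bigr => q _; ring.
Qed.

Lemma dydy_trKJ j k : dy j (dy k trKJ) = 0.
Proof.
rewrite /trKJ !raddf_sum big1 // => i _; rewrite !raddf_sum big1 // => q _ /=.
by rewrite dyM dy_K mul0r add0r dyM dy_K mul0r add0r dy_Jdot -dxyC dy_J raddf0 mulr0.
Qed.

Variables (c : A) (c' : B).
Hypotheses (hc : jconst c) (p_c : p c' = c).

Definition contrJ (u : 'I_n -> A) j := \sum_a J j a * u a.

Definition contrJ3 (u : 'I_n -> 'I_n -> 'I_n -> A) j k l :=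
  contrJ (fun c => contrJ (fun b => contrJ (fun a => u a b c) j) k) l.

Lemma dy_contrJ m u j : dy m (contrJ u j) = contrJ (fun a => dy m (u a)) j.
Proof.
by rewrite raddf_sum; apply: eq_bigr => a _; rewrite dyM dy_J mul0r add0r.
Qed.

Lemma eq_contrJ u v j : (forall a, u a = v a) -> contrJ u j = contrJ v j.
Proof. by move=> uv; apply: eq_bigr => a _; rewrite uv. Qed.

Lemma dy3_p j k l f : dy j (dy k (dy l (p f))) =
  contrJ3 (fun a b c => p (dy a (dy b (dy c f)))) j k l.
Proof.
rewrite p_dy !dy_contrJ; apply: eq_contrJ => e.
by rewrite p_dy dy_contrJ; apply: eq_contrJ => b; rewrite p_dy.
Qed.

(** The argument of the three derivatives in [jDoug] transforms like a vector up to terms quadratic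
    in y, which three vertical derivatives kill. *)
Lemma Doug_change q j k l : \sum_i J i q * jDoug G c j i k l =
  contrJ3 (fun a b d => p (jDoug G' c' a q b d)) j k l.
Proof.
rewrite /jDoug -dy3_p rmorphB !rmorphM p_c -/(jdivN G') divN_change p_yv.
rewrite spray_change -/(jdivN G).
set E := (X in _ = dy _ (dy _ (dy _ X))).
(* The second bracket is the quadratic error: [trKJ] times y'^q from the trace, and y^k [Jdot] from
   the spray coefficients. *)
have -> : E = \sum_i J i q * (G i - c * jdivN G * yv i) +
    (c * trKJ * \sum_j0 yv j0 * J j0 q - h2 * \sum_k0 yv k0 * Jdot k0 q).
  under [in RHS]eq_bigr do rewrite mulrBr.
  rewrite sumrB /E; under [in RHS]eq_bigr do rewrite mulrC.
  rewrite (_ : \sum_(i < n) J i q * (c * jdivN G * yv i) =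
    c * jdivN G * \sum_j0 yv j0 * J j0 q); first by ring.
  by rewrite mulr_sumr; apply: eq_bigr => i _; ring.
rewrite !raddfD !raddfN /= 3?(dyZ _ _ h2c) dy_yJdot.
rewrite (dyZ _ _ (jconst_nat _ _)) dy_Jdot (dyZ _ _ (jconst_nat _ _)) -dxyC dy_J.
rewrite raddf0 !mulr0 subr0.
have -> : dy j (dy k (dy l (c * trKJ * \sum_j0 yv j0 * J j0 q))) = 0.
  rewrite -mulrA 3?(dyZ _ _ hc).
  have dyyJ m : dy m (\sum_i yv i * J i q) = J m q.
    rewrite raddf_sum; under eq_bigr do rewrite dyM dy_yv dy_J mulr0 addr0.
    exact: kron_suml.
  rewrite dyM dyyJ raddfD /= !dyM dyyJ dydy_trKJ dy_J mul0r mulr0 add0r addr0.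
  by rewrite raddfD /= !dyM !dy_J !dydy_trKJ; ring.
rewrite addr0 !raddf_sum; apply: eq_bigr => i _.
by do 3!rewrite dyM dy_J mul0r add0r.
Qed.

(** By [N_change], S (J) = N J - J N', so the Jacobian is parallel for the two connections:
    differentiating it trades one connection term for the other. *)
Lemma jS_contrJ u j : jS G (contrJ u j) = \sum_r G1 G r j * contrJ u r +
  contrJ (fun a => jS G (u a) - \sum_s p (G1 G' s a) * u s) j.
Proof.
transitivity (\sum_a (J j a * jS G (u a) +
    (\sum_r G1 G r j * J r a - \sum_q J j q * p (G1 G' a q)) * u a)).
  rewrite /contrJ [LHS]raddf_sum; apply: eq_bigr => a _ /=; rewrite jSM jS_J N_change.
  by ring.
rewrite big_split /=; under [X in _ + X]eq_bigr do rewrite mulrBl !mulr_suml.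
rewrite sumrB [X in _ + (X - _)]exchange_big [X in _ + (_ - X)]exchange_big.
rewrite addrCA; congr (_ + _).
  apply: eq_bigr => r _; rewrite mulr_sumr.
  by apply: eq_bigr => a _; ring.
rewrite -sumrB; apply: eq_bigr => a _; rewrite mulrBr; congr (_ - _).
by rewrite mulr_sumr; apply: eq_bigr => s _; rewrite mulrA.
Qed.

Lemma contrJ_sum m (v : 'I_n -> A) (u : 'I_n -> 'I_n -> A) :
  contrJ (fun a => \sum_r v r * u r a) m = \sum_r v r * contrJ (u r) m.
Proof.
rewrite /contrJ; under eq_bigr do rewrite mulr_sumr.
rewrite exchange_big; apply: eq_bigr => r _; rewrite mulr_sumr.
by apply: eq_bigr => a _; ring.
Qed.

Lemma contrJD m u v : contrJ (fun a => u a + v a) m = contrJ u m + contrJ v m.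
Proof. by rewrite /contrJ -big_split; apply: eq_bigr => a _; rewrite mulrDr. Qed.

Lemma contrJB m u v : contrJ (fun a => u a - v a) m = contrJ u m - contrJ v m.
Proof. by rewrite /contrJ -sumrB; apply: eq_bigr => a _; rewrite mulrBr. Qed.

Lemma jS_contrJ3 u j k l : jS G (contrJ3 u j k l) =
  \sum_r (G1 G r j * contrJ3 u r k l + G1 G r k * contrJ3 u j r l
           + G1 G r l * contrJ3 u j k r)
  + contrJ3 (fun a b d => jS G (u a b d) - \sum_s (p (G1 G' s a) * u s b d
    + p (G1 G' s b) * u a s d + p (G1 G' s d) * u a b s)) j k l.
Proof.
pose N s a := p (G1 G' s a).
(* [Q] carries the corrections for the first two indices and [Z] those for the third, matching the
   successive uses of [jS_contrJ]. *)
pose Q b d := contrJ (fun a => jS G (u a b d) - \sum_s N s a * u s b d) j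
  - \sum_s N s b * contrJ (fun a => u a s d) j.
pose Z d := \sum_s N s d * contrJ (fun b => contrJ (fun a => u a b s) j) k.
have -> : contrJ3 (fun a b d => jS G (u a b d) - \sum_s (p (G1 G' s a) * u s b d
    + p (G1 G' s b) * u a s d + p (G1 G' s d) * u a b s)) j k l =
    contrJ (fun d => contrJ (Q^~ d) k - Z d) l.
  apply: eq_contrJ => d; rewrite /Z -contrJ_sum -contrJB; apply: eq_contrJ => b.
  rewrite /Q -!contrJ_sum -!contrJB; apply: eq_contrJ => a.
  by rewrite !big_split /= /N; ring.
transitivity (\sum_r G1 G r l * contrJ3 u j k r
  + contrJ (fun d => (\sum_r G1 G r k * contrJ (fun b => contrJ (fun a => u a b d) j) r
    + \sum_r G1 G r j * contrJ (fun b => contrJ (fun a => u a b d) r) k)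
    + (contrJ (Q^~ d) k - Z d)) l).
  rewrite /contrJ3 jS_contrJ; congr (_ + _); apply: eq_contrJ => d.
  rewrite jS_contrJ -!addrA; congr (_ + _); rewrite addrA; congr (_ - _).
  rewrite -contrJ_sum -contrJD; apply: eq_contrJ => b.
  by rewrite jS_contrJ addrA.
by rewrite contrJD contrJD !contrJ_sum !big_split /= /contrJ3; ring.
Qed.

(** Apply S to [Doug_change]. Since J is parallel, its derivatives on the upper and the three lower
    indices turn the connection terms of one chart into those of the other, and [jS_p] moves S
    through the pullback. *)
Theorem nab_Doug_change q j k l : \sum_i J i q * nab13 G (jDoug G c) j i k l =
  contrJ3 (fun a b d => p (nab13 G' (jDoug G' c') a q b d)) j k l.
Proof.
pose D := jDoug G c; pose D' a s b d := p (jDoug G' c' a s b d).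
have DE s a b d : \sum_i J i s * D a i b d = contrJ3 (fun a b d => D' a s b d) a b d.
  exact: Doug_change.
have DJ r : \sum_i G1 G i r * J i q = Jdot r q + \sum_s J r s * p (G1 G' q s).
  by rewrite N_change addrC subrK.
transitivity (jS G (\sum_i J i q * D j i k l)
   + \sum_s p (G1 G' q s) * (\sum_i J i s * D j i k l)
   - \sum_r (G1 G r j * (\sum_i J i q * D r i k l)
            + G1 G r k * (\sum_i J i q * D j i r l)
            + G1 G r l * (\sum_i J i q * D j i k r))).
  rewrite raddf_sum /nab13 -/D.
  under [LHS]eq_bigr do rewrite mulrDr mulr_sumr.
  rewrite big_split /= exchange_big /=.
  transitivity (\sum_i J i q * jS G (D j i k l) + (\sum_r (Jdot r q * D j r k l)
     + \sum_r \sum_s p (G1 G' q s) * (J r s * D j r k l)) -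
     \sum_r \sum_i (G1 G r j * (J i q * D r i k l) + G1 G r k * (J i q * D j i r l)
       + G1 G r l * (J i q * D j i k r))).
    rewrite -addrA; congr (_ + _); rewrite -big_split -sumrB /=.
    apply: eq_bigr => r _.
    transitivity ((\sum_i G1 G i r * J i q) * D j r k l - \sum_i (G1 G r j * (J i q * D r i k l)
       + G1 G r k * (J i q * D j i r l) + G1 G r l * (J i q * D j i k r))).
      by rewrite mulr_suml -sumrB; apply: eq_bigr => i _; ring.
    rewrite DJ mulrDl mulr_suml; congr (_ + _ - _).
    by apply: eq_bigr => s _; ring.
  rewrite addrA -big_split exchange_big /=; congr (_ + _ - _).
  - by apply: eq_bigr => i _; rewrite jSM jS_J addrC.
  - by apply: eq_bigr => s _; rewrite mulr_sumr.
  - by apply: eq_bigr => r _; rewrite !big_split /= !mulr_sumr.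
rewrite DE jS_contrJ3; under [X in _ - X]eq_bigr do rewrite !DE.
under [X in _ + X - _]eq_bigr do rewrite DE.
rewrite addrAC [X in X - _]addrC addrK /contrJ3 -contrJ_sum -contrJD.
apply: eq_contrJ => d; rewrite -contrJ_sum -contrJD; apply: eq_contrJ => b.
rewrite -contrJ_sum -contrJD; apply: eq_contrJ => a.
rewrite /nab13 rmorphD -jS_p rmorph_sum -/(D' a q b d) -addrA; congr (_ + _).
rewrite addrC -sumrB; apply: eq_bigr => s _.
by rewrite !rmorphB !rmorphM /D'; ring.
Qed.
End ChangeOfCoordinates.

(** * Directional derivatives *)

Section Directional.
Variables (R : realType) (V : normedModType R).
Implicit Types (f g : V -> R) (x u v w : V).

Lemma is_derive_lineP f x v (t d : R) :
  is_derive t 1 (fun s : R => f (x + s *: v)) d <-> is_derive (x + t *: v) v f d.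
Proof.
have E : (fun h : R => h^-1 *: (((fun s : R => f (x + s *: v)) \o shift t) (h *: 1)
    - f (x + t *: v))) =
    (fun h => h^-1 *: ((f \o shift (x + t *: v)) (h *: v) - f (x + t *: v))).
  apply/funext => h /=; rewrite [h *: 1]mulr1 scalerDl.
  by rewrite (addrC (h *: v)) addrA (addrC _ (h *: v)).
by split=> -[fv <-]; apply: DeriveDef; move: fv; rewrite /derivable /derive E.
Qed.

Lemma is_derive_line f x v (t : R) : derivable f (x + t *: v) v ->
  is_derive t 1 (fun s : R => f (x + s *: v)) ('D_v f (x + t *: v)).
Proof. by move=> fv; apply/is_derive_lineP/derivableP. Qed.

Lemma is_derive_translate f x u a (d : R) :
  is_derive (x + a) u f d -> is_derive x u (fun y => f (y + a)) d.
Proof.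
have E : (fun h : R => h^-1 *: (((fun y => f (y + a)) \o shift x) (h *: u) - f (x + a))) =
    (fun h => h^-1 *: ((f \o shift (x + a)) (h *: u) - f (x + a))).
  by apply/funext => h /=; rewrite addrA.
by move=> [fu <-]; apply: DeriveDef; move: fu; rewrite /derivable /derive E.
Qed.

Lemma near_normP (P : V -> Prop) x :
  (\forall y \near x, P y) <-> exists2 r : R, 0 < r & forall y, `|y - x| < r -> P y.
Proof.
split=> [/nbhs_ballP[r /= r0 rP]|[r r0 rP]].
  by exists r => // y yx; apply: rP; rewrite -ball_normE /= distrC.
by apply/nbhs_ballP; exists r => //= y; rewrite -ball_normE /= distrC; exact: rP.
Qed.

Lemma directional_mean_value f x v : (forall s : R, 0 <= s <= 1 -> derivable f (x + s *: v) v) ->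
  exists2 s : R, 0 <= s <= 1 & f (x + v) - f x = 'D_v f (x + s *: v).
Proof.
move=> fv.
have ds (s : R) : s \in `[0, 1] ->
    is_derive s 1 (fun s : R => f (x + s *: v)) ('D_v f (x + s *: v)).
  by rewrite in_itv => s01; exact/is_derive_line/fv.
have ds' (s : R) : s \in `]0, 1[ ->
    is_derive s 1 (fun s : R => f (x + s *: v)) ('D_v f (x + s *: v)).
  by rewrite in_itv /= => /andP[s0 s1]; apply: ds; rewrite in_itv /= !ltW.
have dc : {within `[0, 1], continuous (fun s : R => f (x + s *: v))}.
  by apply: derivable_within_continuous => s /ds[].
have [s s01] := MVT_segment ler01 ds' dc.
rewrite scale1r scale0r addr0 subr0 mulr1 => ->; exists s => //.
Qed.

Lemma derivableZdir f x v (c : R) : derivable f x v ->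
  derivable f x (c *: v) /\ 'D_(c *: v) f x = c * 'D_v f x.
Proof.
move=> fv; suff h : is_derive x (c *: v) f ('D_v f x * c).
  by split; [exact: ex_derive | rewrite (derive_val (is_derive := h)) mulrC].
have fv0 : is_derive (0 * c) 1 (fun s : R => f (x + s *: v)) ('D_v f x).
  by apply/is_derive_lineP; rewrite mul0r scale0r addr0; exact/derivableP.
have c0 : is_derive (0 : R) 1 (fun s : R => s * c) c.
  have -> : (fun s : R => s * c) = c \*: (id : R -> R).
    by apply/funext => s; exact: mulrC.
  by apply: is_derive_eq; exact: mulr1.
have := @is_derive1_comp R (fun s => f (x + s *: v)) (fun s => s * c) 0 _ _ fv0 c0.
rewrite (_ : _ \o _ = fun s : R => f (x + s *: (c *: v))); last first.
  by apply/funext => s /=; rewrite scalerA.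
by move/is_derive_lineP; rewrite scale0r addr0.
Qed.

(** The mean value theorem on the segment from x + w, with ['D_v f] close to its value at x, gives
    an estimate uniform in the displacement w. *)
Lemma strictly_derivable f x v : (\forall y \near x, derivable f y v) ->
  {for x, continuous (fun y => 'D_v f y)} -> forall e : R, 0 < e ->
  exists2 d : R, 0 < d & forall w (t : R), `|w| < d -> `|t| < d ->
    `|f (x + w + t *: v) - f (x + w) - t * 'D_v f x| <= e * `|t|.
Proof.
move=> fv cf e e0.
have /near_normP[r r0 rP] : \forall y \near x,
    derivable f y v /\ `|'D_v f x - 'D_v f y| <= e.
  by near=> y; split; [near: y | near: y; move/cvgrPdist_le : cf; exact].
(* This makes |w| + |t| |v| < r, which keeps the whole segment in the good ball. *)
exists (r / (1 + `|v|)).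
  by rewrite divr_gt0 // ltr_pwDl.
move=> w t wd td.
have near_seg s : 0 <= s <= 1 -> `|(x + w + s *: (t *: v)) - x| < r.
  move=> /andP[s0 s1]; rewrite -[x + w + _]addrA [X in X - x]addrC addrK.
  apply: le_lt_trans (ler_normD _ _) _; rewrite !normrZ (ger0_norm s0).
  rewrite -[ltRHS](@divfK _ (1 + `|v|)) ?lt0r_neq0 ?ltr_pwDl // mulrDr mulr1.
  apply: ltr_leD => //; apply: (@le_trans _ _ (`|t| * `|v|)).
    by rewrite ler_piMl // mulr_ge0.
  by rewrite ler_wpM2r // ltW.
have [|s s01 ->] := @directional_mean_value f (x + w) (t *: v).
  by move=> s s01; have [h _] := rP _ (near_seg _ s01); exact: (derivableZdir t h).1.
have [fys /= dfe] := rP _ (near_seg _ s01).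
rewrite (derivableZdir _ fys).2 -mulrBr normrM mulrC ler_wpM2r //.
by rewrite distrC.
Unshelve. all: by end_near. Qed.

Definition C1_along f x v := (\forall y \near x, derivable f y v) /\
  {for x, continuous (fun y => 'D_v f y)}.

(** Increments are added one direction at a time; uniformity in the base point absorbs the partial
    sum already added. *)
Lemma strictly_derivable_sum (I : Type) (s : seq I) f x (v : I -> V) :
  (forall i, C1_along f x (v i)) -> forall e : R, 0 < e ->
  exists2 d : R, 0 < d & forall c : I -> R, (forall i, `|c i| < d) ->
    `|f (x + \sum_(i <- s) c i *: v i) - f x - \sum_(i <- s) c i * 'D_(v i) f x|
      <= e * \sum_(i <- s) `|c i|.
Proof.
move=> fC1 e e0; elim: s => [|i s [d d0 IH]].
  by exists 1 => // c _; rewrite !big_nil !(addr0, subr0, mulr0) subrr normr0.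
have [d' d'0 H] := strictly_derivable (fC1 i).1 (fC1 i).2 e0.
pose B := 1 + \sum_(j <- s) `|v j|.
have B0 : 0 < B by rewrite ltr_pwDl // sumr_ge0.
exists (Num.min (Num.min d d') (d' / B)); first by rewrite !lt_min d0 d'0 divr_gt0.
move=> c cd.
have cd1 j : `|c j| < d by move: (cd j); rewrite !lt_min => /andP[/andP[]].
have cd2 j : `|c j| < d' by move: (cd j); rewrite !lt_min => /andP[/andP[]].
have cd3 j : `|c j| <= d' / B by move: (cd j); rewrite !lt_min => /andP[_ /ltW].
rewrite !big_cons; set w := \sum_(j <- s) c j *: v j.
have wd : `|w| < d'.
  apply: (@le_lt_trans _ _ (d' / B * \sum_(j <- s) `|v j|)).
    rewrite mulr_sumr; apply: le_trans (ler_norm_sum _ _ _) _.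
    by apply: ler_sum => j _; rewrite normrZ ler_wpM2r.
  rewrite mulrAC -mulrA gtr_pMr // ltr_pdivrMr // mul1r /B.
  by rewrite ltrDr.
have := lerD (H _ _ wd (cd2 i)) (IH _ cd1); rewrite -/w -mulrDr.
apply: le_trans; apply: le_trans (ler_normD _ _).
rewrite [c i *: v i + w]addrC addrA le_eqVlt; apply/orP; left; apply/eqP.
by congr `|_|; ring.
Qed.

(** The increment of [Phi] is expanded in the directions [v i], and [strictly_derivable_sum] bounds
    the error by a small multiple of the coordinate increments, which are O(h). *)
Lemma derivable_chain (W : normedModType R) (I : finType) f (Phi : W -> V)
    (v : I -> V) (phi : I -> W -> R) (z u : W) :
  (forall y, Phi y = \sum_i phi i y *: v i) ->
  (forall i, derivable (phi i) z u) ->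
  (forall i, C1_along f (Phi z) (v i)) ->
  is_derive z u (f \o Phi) (\sum_i 'D_u (phi i) z * 'D_(v i) f (Phi z)).
Proof.
move=> PhiE dphi fC1.
pose c h i := phi i (h *: u + z) - phi i z.
pose q h := h^-1 * (f (Phi (h *: u + z)) - f (Phi z)).
have PhiD h : Phi (h *: u + z) = Phi z + \sum_i c h i *: v i.
  rewrite !PhiE -big_split; apply: eq_bigr => i _ /=.
  by rewrite -scalerDl /c [phi i z + _]addrC subrK.
have cv i : (fun h : R => h^-1 * c h i) @ 0^' --> 'D_u (phi i) z by exact: dphi i.
suff qv : q @ 0^' --> \sum_i 'D_u (phi i) z * 'D_(v i) f (Phi z).
  by apply: DeriveDef; [apply/cvg_ex; eexists; exact: qv | exact/cvg_lim].
have sv : (fun h : R => \sum_i h^-1 * c h i * 'D_(v i) f (Phi z)) @ 0^' -->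
    \sum_i 'D_u (phi i) z * 'D_(v i) f (Phi z).
  apply: cvg_big => [|i _]; first exact: add_continuous.
  exact: cvgMr_tmp (cv i).
rewrite -[X in _ --> X]addr0.
have -> : q = (fun h : R => \sum_i h^-1 * c h i * 'D_(v i) f (Phi z)) \+
    (fun h => q h - \sum_i h^-1 * c h i * 'D_(v i) f (Phi z)).
  by apply/funext => h /=; rewrite addrC subrK.
apply: cvgD sv _; apply/cvgr0Pnorm_le => e e0.
(* For small h, [B] bounds the sum of the quotients |c h i / h|, so an error rate of e / B yields
   e. *)
pose B := 1 + \sum_i (`|'D_u (phi i) z| + 1).
have B0 : 0 < B by rewrite ltr_pwDl // sumr_ge0.
have eB : 0 < e / B by rewrite divr_gt0.
have [d d0 H] := strictly_derivable_sum (index_enum I) fC1 eB.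
near=> h.
have cb i : `|h^-1 * c h i| <= `|'D_u (phi i) z| + 1.
  move: i; near: h; apply: filter_forall => i; near=> h.
  rewrite -[h^-1 * _](subrK ('D_u (phi i) z)) addrC.
  apply: le_trans (ler_normD _ _) _; rewrite lerD2l.
  near: h; move/cvgrPdist_le: (cv i) => /(_ _ ltr01).
  by apply: filterS => h; rewrite distrC.
have h0 : h != 0 by near: h; exact: nbhs_dnbhs_neq.
have cd i : `|c h i| < d.
  rewrite -[c h i]mul1r -(divff h0) -mulrA normrM.
  apply: (@le_lt_trans _ _ (`|h| * B)).
    rewrite ler_wpM2l // (le_trans (cb i)) // /B.
    by rewrite (bigD1 i) //= addrCA lerDl addr_ge0 // sumr_ge0.
  by rewrite -ltr_pdivlMr //; near: h; apply: dnbhs0_lt; rewrite divr_gt0.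
have := H _ cd; rewrite -PhiD => Hh.
rewrite /q.
have -> : h^-1 * (f (Phi (h *: u + z)) - f (Phi z)) -
    \sum_i h^-1 * c h i * 'D_(v i) f (Phi z) =
   h^-1 * (f (Phi (h *: u + z)) - f (Phi z) - \sum_i c h i * 'D_(v i) f (Phi z)).
  by rewrite [RHS]mulrBr mulr_sumr; congr (_ - _); apply: eq_bigr => i _; rewrite mulrA.
rewrite normrM; apply: (@le_trans _ _ (`|h^-1| * (e / B * \sum_i `|c h i|))).
  by rewrite ler_wpM2l.
rewrite mulrCA mulr_sumr -mulrA ger_pMr // ler_pdivrMl // mulr1.
apply: (@le_trans _ _ (\sum_i (`|'D_u (phi i) z| + 1))); last by rewrite /B lerDr.
by apply: ler_sum => i _; rewrite -normrM.
Unshelve. all: by end_near. Qed.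

(** The mean value theorem along t u for y |-> f (y + t v) - f y reduces the second difference to an
    increment of ['D_u f] along t v, to which [strictly_derivable] applies. *)
Lemma second_difference f x u v : (\forall y \near x, derivable f y u) ->
  C1_along (fun y => 'D_u f y) x v -> forall e : R, 0 < e ->
  exists2 d : R, 0 < d & forall t : R, `|t| < d ->
    `|f (x + t *: u + t *: v) - f (x + t *: u) - f (x + t *: v) + f x
      - t ^+ 2 * 'D_v (fun y => 'D_u f y) x| <= e * t ^+ 2.
Proof.
move=> /near_normP[r r0 rP] [C1a C1b] e e0.
have [d d0 H] := strictly_derivable C1a C1b e0.
pose B := 1 + `|u| + `|v|.
have B0 : 0 < B by rewrite /B -addrA ltr_pwDl // addr_ge0.
exists (Num.min d (Num.min r d / B)); first by rewrite lt_min d0 divr_gt0 // lt_min r0.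
move=> t; rewrite lt_min ltr_pdivlMr // lt_min => /and3P[td tr td2].
have tuv s : 0 <= s <= 1 -> `|s *: (t *: u)| <= `|t| * `|u|.
  move=> /andP[s0 s1]; rewrite !normrZ ger0_norm // ler_piMl // mulr_ge0 //.
have tB : `|t| * B = `|t| + `|t| * `|u| + `|t| * `|v| by rewrite /B !mulrDr mulr1.
have near1 s : 0 <= s <= 1 -> derivable f (x + s *: (t *: u)) u.
  move=> /tuv s01; apply: rP; rewrite [X in X - x]addrC addrK (le_lt_trans s01) //.
  apply: le_lt_trans tr; rewrite tB addrAC lerDr addr_ge0 // mulr_ge0 //.
have near2 s : 0 <= s <= 1 -> derivable f (x + t *: v + s *: (t *: u)) u.
  move=> /tuv s01; apply: rP; rewrite -[x + _ + _]addrA [X in X - x]addrC addrK.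
  apply: le_lt_trans tr; rewrite tB -addrA.
  by apply: le_trans (ler_normD _ _) _; rewrite normrZ; have := normr_ge0 t; lra.
have dsh s : 0 <= s <= 1 -> is_derive (x + s *: (t *: u)) u
    (fun y => f (y + t *: v)) ('D_u f (x + s *: (t *: u) + t *: v)).
  move=> s01; apply: is_derive_translate; rewrite addrAC.
  exact/derivableP/near2.
pose g y := f (y + t *: v) - f y.
have dg s : 0 <= s <= 1 -> is_derive (x + s *: (t *: u)) u g
   ('D_u f (x + s *: (t *: u) + t *: v) - 'D_u f (x + s *: (t *: u))).
  by move=> s01; apply: is_deriveB; [exact: dsh | exact/derivableP/near1].
have [|s s01 gE] := @directional_mean_value g x (t *: u).
  by move=> s s01; apply: (derivableZdir _ _).1; have [] := dg _ s01.
have -> : f (x + t *: u + t *: v) - f (x + t *: u) - f (x + t *: v) + f x = g (x + t *: u) - g x.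
  by rewrite /g; ring.
have [dgs dgE] := dg _ s01.
rewrite gE (derivableZdir _ dgs).2 dgE expr2 -mulrA -mulrBr normrM.
rewrite -[t * t]/(t ^+ 2) -real_normK ?num_real // expr2 mulrCA ler_wpM2l //.
apply: H => //; apply: le_lt_trans (tuv _ s01) _; apply: le_lt_trans td2.
by rewrite tB addrAC lerDr addr_ge0 // mulr_ge0.
Qed.

(** The second difference is symmetric in u and v, so both mixed derivatives approximate the same
    quantity up to e t^2. *)
Lemma derive_sym f x u v :
  (\forall y \near x, derivable f y u) -> (\forall y \near x, derivable f y v) ->
  C1_along (fun y => 'D_u f y) x v -> C1_along (fun y => 'D_v f y) x u ->
  'D_v (fun y => 'D_u f y) x = 'D_u (fun y => 'D_v f y) x.
Proof.
move=> fu fv fuv fvu; apply/eqP; rewrite -subr_eq0 -normr_le0; apply/ler_addgt0Pl.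
move=> e e0; rewrite addr0.
have e20 : 0 < e / 2 by rewrite divr_gt0.
have [d d0 H] := second_difference fu fuv e20.
have [d' d'0 H'] := second_difference fv fvu e20.
pose t := Num.min d d' / 2.
have t0 : 0 < t by rewrite divr_gt0 // lt_min d0.
have td : `|t| < d /\ `|t| < d'.
  rewrite gtr0_norm // /t; split; rewrite ltr_pdivrMr //;
  by rewrite gt_min ?ltr_pMr ?ltr1n // ?d0 ?d'0 ?orbT.
have := lerD (H _ td.1) (H' _ td.2); rewrite -mulrDl -splitr.
rewrite [x + t *: v + t *: u]addrAC [X in _ + X <= _]distrC => h.
have {h} := le_trans (ler_normD _ _) h.
move: ('D_v _ x) ('D_u _ x) (f (x + _ + _)) (f (x + t *: u)) (f (x + t *: v)) (f x).
move=> D1 D2 f1 f2 f3 f4.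
rewrite (_ : _ + _ = - (t ^+ 2 * (D1 - D2))); last by ring.
rewrite normrN normrM (ger0_norm (sqr_ge0 _)) mulrC ler_pM2r //.
by rewrite exprn_gt0.
Qed.

End Directional.

(** * The ring of smooth functions on an open set *)

Lemma is_derive_lin (R : realType) (V : normedModType R) (f : V -> R) x v :
  (forall x v (h : R), f (h *: v + x) = h * f v + f x) -> is_derive x v f (f v).
Proof.
move=> fl; suff fv : (fun h : R => h^-1 *: ((f \o shift x) (h *: v) - f x)) @ 0^' --> f v.
  by apply: DeriveDef; [apply/cvg_ex; exists (f v) | exact/cvg_lim].
apply: (@cvg_trans _ ((cst (f v)) @ (0 : R)^')); last exact: cvg_cst.
apply: near_eq_cvg; near=> h.
rewrite /= fl addrK; apply/esym; rewrite /GRing.scale /= mulKf //.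
by near: h; exact: nbhs_dnbhs_neq.
Unshelve. all: by end_near. Qed.

Lemma derive_lin (R : realType) (V : normedModType R) (f : V -> R) x v :
  (forall x v (h : R), f (h *: v + x) = h * f v + f x) -> 'D_v f x = f v.
Proof. by move=> fl; have [] := is_derive_lin x v fl. Qed.

Section CkTheory.
Variables (R : realType) (V : normedModType R).
Implicit Types (W : normedModType R) (A B : set V) (k : nat).

Lemma CkW W k A (f : V -> W) : Ck k.+1 A f -> Ck k A f.
Proof.
elim: k f => [|k IH] f [fc fd]; split=> // v.
by have [fv /IH] := fd v.
Qed.

Lemma Ck_subset W k A B (f : V -> W) : B `<=` A -> Ck k A f -> Ck k B f.
Proof.
move=> BA; elim: k f => [|k IH] f [fc fd]; split=> //; try by move=> x /BA; exact: fc.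
by move=> v; have [fv /IH ?] := fd v; split=> // x /BA; exact: fv.
Qed.

Lemma Ck_eq W k A (f g : V -> W) : open A -> (forall x, A x -> f x = g x) ->
  Ck k A f -> Ck k A g.
Proof.
move=> oA; elim: k f g => [|k IH] f g fg [fc fd]; (split=> [x Ax|]).
- rewrite /prop_for /continuous_at -fg //; apply: cvg_trans (fc x Ax).
  by apply: near_eq_cvg; near=> y; apply: fg; near: y; exact: open_nbhs_nbhs.
- by [].
- rewrite /prop_for /continuous_at -fg //; apply: cvg_trans (fc x Ax).
  by apply: near_eq_cvg; near=> y; apply: fg; near: y; exact: open_nbhs_nbhs.
- have nfg x : A x -> \near x, f x = g x.
    by move=> Ax; near=> y; apply: fg; near: y; exact: open_nbhs_nbhs.
  move=> v; have [fv fvk] := fd v; split=> [x Ax|].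
    by apply: near_eq_derivable (fv x Ax); exact: nfg.
  by apply: IH fvk => x Ax; apply: near_eq_derive; exact: nfg.
Unshelve. all: by end_near. Qed.

Lemma Ck_cst W k A (c : W) : Ck k A (cst c).
Proof.
elim: k c => [|k IH] c; split=> //; try by move=> x _; exact: cvg_cst.
move=> v; split; first by move=> x _; exact: derivable_cst.
rewrite (_ : (fun x => _) = cst 0); first exact: IH.
by apply/funext => x; exact: derive_cst.
Qed.

Lemma Ck_lin k A (f : V -> R) : (forall x v (h : R), f (h *: v + x) = h * f v + f x) ->
  continuous f -> Ck k A f.
Proof.
move=> fl fc; case: k => [|k]; split=> //; try by move=> x _; exact: fc.
move=> v; split; first by move=> x _; have [] := is_derive_lin x v fl.
rewrite (_ : (fun x => _) = cst (f v)); first exact: Ck_cst.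
by apply/funext => x; exact: derive_lin.
Qed.

Section Scalar.
Variable A : set V.
Hypothesis oA : open A.
Implicit Types f g : V -> R.

Lemma CkD k f g : Ck k A f -> Ck k A g -> Ck k A (fun x => f x + g x).
Proof.
elim: k f g => [|k IH] f g [fc fd] [gc gd]; (split=> [x Ax|]) => //;
  try by apply: continuousD; [exact: fc | exact: gc].
move=> v; have [fv fvk] := fd v; have [gv gvk] := gd v; split=> [x Ax|].
  by apply: derivableD; [exact: fv | exact: gv].
apply: (Ck_eq oA (f := fun x => 'D_v f x + 'D_v g x)); last exact: IH.
by move=> x Ax; rewrite [RHS]deriveD //; [exact: fv | exact: gv].
Qed.

Lemma CkM k f g : Ck k A f -> Ck k A g -> Ck k A (fun x => f x * g x).
Proof.
elim: k f g => [|k IH] f g fk gk; have [fc fd] := fk; have [gc gd] := gk;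
  (split=> [x Ax|]) => //;
  try by apply: continuousM; [exact: fc | exact: gc].
move=> v; have [fv fvk] := fd v; have [gv gvk] := gd v; split=> [x Ax|].
  by apply: derivableM; [exact: fv | exact: gv].
apply: (Ck_eq oA (f := fun x => f x * 'D_v g x + g x * 'D_v f x)).
  by move=> x Ax; rewrite [RHS]deriveM //; [exact: fv | exact: gv].
by apply: CkD; apply: IH => //; exact: CkW.
Qed.

Lemma CkV k f : (forall x, A x -> f x != 0) -> Ck k A f -> Ck k A (fun x => (f x)^-1).
Proof.
move=> f0; elim: k => [|k IH] fk; have [fc fd] := fk; (split=> [x Ax|]) => //;
  try by apply: cvgV; [exact: f0 | exact: fc].
move=> v; have [fv fvk] := fd v; split=> [x Ax|].
  by apply: derivableV; [exact: f0 | exact: fv].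
apply: (Ck_eq oA (f := fun x => (-1) * (((f x)^-1 * (f x)^-1) * 'D_v f x))).
  move=> x Ax; rewrite [RHS]deriveV //; [|exact: f0 | exact: fv].
  by rewrite /GRing.scale /= expr2 invfM mulN1r mulNr.
have fVk := IH (CkW fk).
by apply: CkM; [exact: Ck_cst | apply: CkM => //; exact: CkM].
Qed.

Lemma Ck_sum (I : Type) (s : seq I) k (f : I -> V -> R) :
  (forall i, Ck k A (f i)) -> Ck k A (fun x => \sum_(i <- s) f i x).
Proof.
move=> fk; elim: s => [|i s IH].
  by apply: (Ck_eq oA (f := cst 0)); [move=> x _; rewrite big_nil | exact: Ck_cst].
apply: (Ck_eq oA (f := fun x => f i x + \sum_(j <- s) f j x)); last exact: CkD.
by move=> x _; rewrite big_cons.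
Qed.

Lemma smooth_derivable f x v : smooth_on A f -> A x -> derivable f x v.
Proof. by move=> /(_ 1%N)[_ /(_ v)[+ _]]; apply. Qed.

Lemma smooth_continuous f x : smooth_on A f -> A x -> {for x, continuous f}.
Proof. by move=> /(_ 0%N)[+ _]; apply. Qed.

Lemma smooth_derive f v : smooth_on A f -> smooth_on A (fun x => 'D_v f x).
Proof. by move=> fs k; have [_ /(_ v)[]] := fs k.+1. Qed.

Lemma smooth_C1_along f x v : smooth_on A f -> A x -> C1_along f x v.
Proof.
move=> fs Ax; split; last exact: smooth_continuous (smooth_derive v fs) Ax.
near=> y; apply: smooth_derivable fs _.
by near: y; exact: open_nbhs_nbhs.
Unshelve. all: by end_near. Qed.

Lemma smooth_derive_sym f x u v : smooth_on A f -> A x ->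
  'D_u (fun y => 'D_v f y) x = 'D_v (fun y => 'D_u f y) x.
Proof.
move=> fs Ax; apply: derive_sym.
- exact: (smooth_C1_along v fs Ax).1.
- exact: (smooth_C1_along u fs Ax).1.
- exact: smooth_C1_along (smooth_derive v fs) Ax.
- exact: smooth_C1_along (smooth_derive u fs) Ax.
Qed.
End Scalar.

End CkTheory.

(** Induction on [k] for all smooth [f]: the chain rule writes a derivative of the composite as a
    sum of products of smooth functions with composites of derivatives of [f]. *)
Lemma Ck_comp (R : realType) (V U : normedModType R) (I : finType) (A : set U) (B : set V) (k : nat) (Phi : U -> V)
    (phi : I -> U -> R) (v : I -> V) (f : V -> R) :
  open A -> open B -> (forall z, A z -> B (Phi z)) ->
  (forall z, Phi z = \sum_i phi i z *: v i) -> (forall i, smooth_on A (phi i)) ->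
  smooth_on B f -> Ck k A (fun z => f (Phi z)).
Proof.
move=> oA oB AB PhiE phis.
have cPhi (g : V -> R) z : smooth_on B g -> A z -> {for z, continuous (fun z => g (Phi z))}.
  move=> gs Az; apply: continuous_comp; last exact: smooth_continuous gs (AB _ Az).
  rewrite (_ : Phi = fun z => \sum_i phi i z *: v i); last exact/funext.
  apply: cvg_big => [|i _]; first exact: add_continuous.
  by apply: cvgZr_tmp; exact: smooth_continuous (phis i) Az.
elim: k f => [|k IH] f fs; (split=> [z Az|]) => //; try exact: cPhi.
have chain z u : A z -> is_derive z u (fun z => f (Phi z))
    (\sum_i 'D_u (phi i) z * 'D_(v i) f (Phi z)).
  move=> Az; apply: derivable_chain PhiE _ _ => i.
    exact: smooth_derivable (phis i) Az.
  exact: smooth_C1_along fs (AB _ Az).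
move=> u; split=> [z Az|]; first by have [] := chain z u Az.
apply: (Ck_eq oA (f := fun z => \sum_i 'D_u (phi i) z * 'D_(v i) f (Phi z))).
  by move=> z Az; have [_ ->] := chain z u Az.
apply: Ck_sum => // i; apply: CkM => //; first exact: smooth_derive.
exact: IH (smooth_derive _ fs).
Qed.

Record opens (R : realType) (V : normedModType R) :=
  Opens { oset :> V -> Prop ; oset_open : open (oset : set V) }.

(* Values outside [U] are normalized to 0, so that equality on [U] is equality. *)
Record Cinf (R : realType) (V : normedModType R) (U : opens V) := MkCinf {
  cf :> V -> R ;
  cf_smooth : smooth_on U cf ;
  cf_out : forall x, ~ U x -> cf x = 0
}.

Section CinfRing.
Variables (R : realType) (V : normedModType R) (U : opens V).
Local Notation CU := (Cinf U).
Implicit Types (f g h : CU).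

Lemma Cinf_eq f g : (forall x, U x -> f x = g x) -> f = g.
Proof.
case: f g => [f fs f0] [g gs g0] /= fg.
have E : f = g.
  by apply/funext => x; have [/fg//|Ux] := pselect (U x); rewrite f0 // g0.
by subst g; congr MkCinf; exact: Prop_irrelevance.
Qed.

Definition restr0 (f : V -> R) x : R := if pselect (U x) then f x else 0.

Lemma restr0E (f : V -> R) x : U x -> restr0 f x = f x.
Proof. by rewrite /restr0; case: pselect. Qed.

Lemma restr0_out (f : V -> R) x : ~ U x -> restr0 f x = 0.
Proof. by rewrite /restr0; case: pselect. Qed.

Lemma restr0_smooth (f : V -> R) : smooth_on U f -> smooth_on U (restr0 f).
Proof. by move=> fs k; apply: Ck_eq (oset_open U) _ (fs k) => x /restr0E. Qed.

Definition to_Cinf (f : V -> R) (fs : smooth_on U f) : CU :=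
  MkCinf (restr0_smooth fs) (@restr0_out f).

Lemma to_CinfE (f : V -> R) (fs : smooth_on U f) x : U x -> to_Cinf fs x = f x.
Proof. exact: restr0E. Qed.

Definition cadd f g := to_Cinf (fun k => CkD (oset_open U) (cf_smooth f k) (cf_smooth g k)).
Definition cmul f g := to_Cinf (fun k => CkM (oset_open U) (cf_smooth f k) (cf_smooth g k)).
Definition ccst (c : R) := to_Cinf (fun k => Ck_cst k U c).
Definition copp f := cmul (ccst (-1)) f.

Lemma caddE f g x : U x -> cadd f g x = f x + g x. Proof. exact: to_CinfE. Qed.
Lemma cmulE f g x : U x -> cmul f g x = f x * g x. Proof. exact: to_CinfE. Qed.
Lemma ccstE c x : U x -> ccst c x = c. Proof. exact: to_CinfE. Qed.
Lemma coppE f x : U x -> copp f x = - f x.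
Proof. by move=> Ux; rewrite cmulE // ccstE // mulN1r. Qed.

HB.instance Definition _ := gen_eqMixin CU.
HB.instance Definition _ := gen_choiceMixin CU.

Fact caddA : associative cadd.
Proof. by move=> f g h; apply: Cinf_eq => x Ux; rewrite !caddE // addrA. Qed.
Fact caddC : commutative cadd.
Proof. by move=> f g; apply: Cinf_eq => x Ux; rewrite !caddE // addrC. Qed.
Fact cadd0 : left_id (ccst 0) cadd.
Proof. by move=> f; apply: Cinf_eq => x Ux; rewrite !caddE // ccstE // add0r. Qed.
Fact caddN : left_inverse (ccst 0) copp cadd.
Proof. by move=> f; apply: Cinf_eq => x Ux; rewrite !caddE // coppE // addNr ccstE. Qed.
HB.instance Definition _ := GRing.isZmodule.Build CU caddA caddC cadd0 caddN.
Fact cmulA : associative cmul.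
Proof. by move=> f g h; apply: Cinf_eq => x Ux; rewrite !cmulE // mulrA. Qed.
Fact cmulC : commutative cmul.
Proof. by move=> f g; apply: Cinf_eq => x Ux; rewrite !cmulE // mulrC. Qed.
Fact cmul1 : left_id (ccst 1) cmul.
Proof. by move=> f; apply: Cinf_eq => x Ux; rewrite cmulE // ccstE // mul1r. Qed.
Fact cmulDl : left_distributive cmul +%R.
Proof.
by move=> f g h; apply: Cinf_eq => x Ux; rewrite cmulE // !caddE // !cmulE // mulrDl.
Qed.
HB.instance Definition _ := GRing.Zmodule_isComPzRing.Build CU cmulA cmulC cmul1 cmulDl.

Section Eval.
Variable x : V.
(** The membership proof is an argument because evaluation is a ring morphism only at points of [U]:
    outside, 1 evaluates to 0. *)
Definition evC (_ : U x) f : R := f x.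
Variable Ux : U x.
Fact evC_additive : additive (evC Ux).
Proof. by move=> f g; rewrite /evC caddE // coppE. Qed.
HB.instance Definition _ := GRing.isAdditive.Build CU R (evC Ux) evC_additive.
Fact evC_multiplicative : multiplicative (evC Ux).
Proof. by split=> [f g|]; rewrite /evC ?cmulE // ccstE. Qed.
HB.instance Definition _ := GRing.isMultiplicative.Build CU R (evC Ux) evC_multiplicative.
End Eval.

Definition cD v f := to_Cinf (smooth_derive v (cf_smooth f)).
Lemma cDE v f x : U x -> cD v f x = 'D_v f x. Proof. exact: to_CinfE. Qed.

Fact cD_additive v : additive (cD v).
Proof.
move=> f g; apply: Cinf_eq => x Ux; rewrite caddE // coppE // !cDE //.
rewrite (near_eq_derive (g := (f : V -> R) - (g : V -> R))).
  by rewrite deriveB //; exact: smooth_derivable (cf_smooth _) Ux.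
near=> y; have Uy : U y by near: y; apply: open_nbhs_nbhs; split=> //; exact: oset_open.
by rewrite caddE // coppE.
Unshelve. all: by end_near. Qed.
HB.instance Definition _ v := GRing.isAdditive.Build CU CU (cD v) (cD_additive v).

Lemma cDM v f g : cD v (f * g) = cD v f * g + f * cD v g.
Proof.
apply: Cinf_eq => x Ux; rewrite caddE // !cmulE // !cDE //.
rewrite (near_eq_derive (g := (f : V -> R) * (g : V -> R))).
  rewrite deriveM; [|exact: smooth_derivable (cf_smooth _) Ux..].
  by rewrite /GRing.scale /= addrC mulrC.
near=> y; have Uy : U y by near: y; apply: open_nbhs_nbhs; split=> //; exact: oset_open.
by rewrite cmulE.
Unshelve. all: by end_near. Qed.

Lemma cDDE u v f x : U x -> cD u (cD v f) x = 'D_u (fun y => 'D_v f y) x.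
Proof.
move=> Ux; transitivity ('D_u (cD v f : V -> R) x); first exact: cDE.
apply: near_eq_derive; near=> y; apply: cDE.
by near: y; apply: open_nbhs_nbhs; split=> //; exact: oset_open.
Unshelve. all: by end_near. Qed.

Lemma cDC u v f : cD u (cD v f) = cD v (cD u f).
Proof.
apply: Cinf_eq => x Ux.
transitivity ('D_u (fun y => 'D_v f y) x); first exact: cDDE.
transitivity ('D_v (fun y => 'D_u f y) x); last exact/esym/cDDE.
exact: (smooth_derive_sym (oset_open U)) (cf_smooth f) Ux.
Qed.

Lemma cinvP f : (forall x, U x -> f x != 0) -> exists g, f * g = 1.
Proof.
move=> f0; exists (to_Cinf (fun k => CkV (oset_open U) f0 (cf_smooth f k))).
by apply: Cinf_eq => x Ux; rewrite cmulE // to_CinfE // mulfV ?ccstE // f0.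
Qed.

End CinfRing.

(** * Functions on an open subset of the tangent bundle *)

Section TVJets.
Variables (R : realType) (n : nat).
Local Notation TV := ('rV[R]_n * 'rV[R]_n)%type.
Local Notation ex k := ((delta_mx ord0 k : 'rV[R]_n, 0 : 'rV[R]_n) : TV).
Local Notation ey k := ((0 : 'rV[R]_n, delta_mx ord0 k : 'rV[R]_n) : TV).

Lemma yc_lin i (x v : TV) (h : R) : yc i (h *: v + x) = h * yc i v + yc i x.
Proof. by rewrite /yc /= !mxE. Qed.

Lemma yc_continuous i : continuous (@yc R n i).
Proof.
move=> z; apply: (@continuous_comp _ _ _ snd (fun y : 'rV[R]_n => y ord0 i)).
  exact: cvg_snd.
exact: coord_continuous.
Qed.

Lemma yc_smooth i (A : set TV) : smooth_on A (@yc R n i).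
Proof. by move=> k; apply: Ck_lin; [exact: yc_lin | exact: yc_continuous]. Qed.

Variable U : opens TV.

Definition ycC i : Cinf U := to_Cinf (@yc_smooth i U).

Lemma cD_ycC i v : cD v (ycC i) = ccst U (yc i v).
Proof.
apply: Cinf_eq => z Uz; rewrite cDE // ccstE //.
rewrite (near_eq_derive (g := yc i)); first exact: derive_lin (yc_lin i).
near=> y; apply: to_CinfE.
by near: y; apply: open_nbhs_nbhs; split=> //; exact: oset_open.
Unshelve. all: by end_near. Qed.

Lemma ccst_nat m : ccst U m%:R = m%:R.
Proof. by apply: Cinf_eq => z Uz; rewrite ccstE // -[RHS]/(evC Uz _) rmorph_nat. Qed.

Definition TVjets : jetring n.
Proof.
apply: (@JetRing n (Cinf U) (fun k => cD (ex k)) (fun k => cD (ey k)) (@ycC)).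
- by move=> k f g; exact: cDM.
- by move=> k f g; exact: cDM.
- by move=> j k f; exact: cDC.
- by move=> j k f; exact: cDC.
- by move=> j k f; exact: cDC.
- by move=> k i; rewrite /= cD_ycC /yc /= mxE.
- move=> k i; rewrite /= cD_ycC /yc /= mxE /= -ccst_nat.
  by rewrite eq_sym.
Defined.

Lemma ccst_invK m : (0 < m)%N -> (ccst U m%:R^-1 : TVjets) * m%:R = 1.
Proof.
move=> m0; suff -> : (m%:R : TVjets) = ccst U m%:R.
  by apply: Cinf_eq => z Uz; rewrite cmulE // !ccstE // mulVf // pnatr_eq0 -lt0n.
exact/esym/ccst_nat.
Qed.

(** Agreement is required on [U] alone, which suffices for derivatives because [U] is open. *)
Definition represents (f : TV -> R) (a : TVjets) := forall z, U z -> f z = (a : Cinf U) z.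
Implicit Types (f g : TV -> R) (a b : TVjets).

Lemma repD f g a b : represents f a -> represents g b -> represents (fun z => f z + g z) (a + b).
Proof. by move=> fa gb z Uz; rewrite -[RHS]/(evC Uz _) rmorphD /= /evC -fa // -gb. Qed.
Lemma repB f g a b : represents f a -> represents g b -> represents (fun z => f z - g z) (a - b).
Proof. by move=> fa gb z Uz; rewrite -[RHS]/(evC Uz _) rmorphB /= /evC -fa // -gb. Qed.
Lemma repM f g a b : represents f a -> represents g b -> represents (fun z => f z * g z) (a * b).
Proof. by move=> fa gb z Uz; rewrite -[RHS]/(evC Uz _) rmorphM /= /evC -fa // -gb. Qed.
Lemma rep_nat m : represents (fun=> m%:R) m%:R.
Proof. by move=> z Uz; rewrite -[RHS]/(evC Uz _) rmorph_nat. Qed.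
Lemma rep_cst c : represents (fun=> c) (ccst U c).
Proof. by move=> z Uz; rewrite ccstE. Qed.
Lemma rep_yc i : represents (yc i) (yv i).
Proof. by move=> z Uz; rewrite to_CinfE. Qed.
Lemma rep_sum (I : finType) (f : I -> TV -> R) (a : I -> TVjets) :
  (forall i, represents (f i) (a i)) -> represents (fun z => \sum_i f i z) (\sum_i a i).
Proof.
move=> fa z Uz; rewrite -[RHS]/(evC Uz _) rmorph_sum.
by apply: eq_bigr => i _; exact: fa.
Qed.

Lemma rep_near f a z : represents f a -> U z -> \near z, f z = (a : Cinf U) z.
Proof.
move=> fa Uz; near=> y; apply: fa.
by near: y; apply: open_nbhs_nbhs; split=> //; exact: oset_open.
Unshelve. all: by end_near. Qed.

Lemma rep_px k f a : represents f a -> represents (px k f) (dx k a).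
Proof.
by move=> fa z Uz; rewrite to_CinfE //; apply: near_eq_derive; exact: rep_near.
Qed.
Lemma rep_py k f a : represents f a -> represents (py k f) (dy k a).
Proof.
by move=> fa z Uz; rewrite to_CinfE //; apply: near_eq_derive; exact: rep_near.
Qed.

Lemma rep_smooth f a : represents f a -> smooth_on U f.
Proof.
move=> fa k; apply: Ck_eq (oset_open U) _ (cf_smooth (a : Cinf U) k).
by move=> z Uz; rewrite fa.
Qed.

Lemma smooth_rep f : smooth_on U f -> exists a, represents f a.
Proof. by move=> fs; exists (to_Cinf fs : Cinf U) => z Uz; rewrite to_CinfE. Qed.

Lemma jconst_cst c : jconst (ccst U c : TVjets).
Proof.
by split=> k; apply: Cinf_eq => z Uz; rewrite cDE // ccstE //;
  rewrite (near_eq_derive (g := cst c)) ?derive_cst //;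
  near=> y; apply: to_CinfE;
  near: y; apply: open_nbhs_nbhs; split=> //; exact: oset_open.
Unshelve. all: by end_near. Qed.

Section SprayTransfer.
Variables (G : 'I_n -> TV -> R) (g : 'I_n -> TVjets).
Hypothesis Gg : forall i, represents (G i) (g i).

Lemma rep_Nconn r m : represents (Nconn G r m) (G1 g r m).
Proof. exact: rep_py. Qed.
Lemma rep_Berwald i r m : represents (Berwald G i r m) (G2 g i r m).
Proof. exact: rep_py (rep_py _ _). Qed.

Lemma rep_Riem i k : represents (Riem G i k) (jRiem g i k).
Proof.
apply: repB; last by apply: rep_sum => m; apply: repM; apply: rep_py.
apply: repD; last first.
  by apply: repM (rep_nat 2) _; apply: rep_sum => m; apply: repM => //; do 2!apply: rep_py.
apply: repB; first by apply: repM (rep_nat 2) _; apply: rep_px.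
by apply: rep_sum => m; apply: repM (rep_yc m); apply: rep_px; apply: rep_py.
Qed.

Definition cn1 : TVjets := ccst U (n%:R - 1)^-1.
Definition cn2 : TVjets := ccst U (n%:R + 1)^-1.
Definition c3 : TVjets := ccst U 3^-1.

Lemma rep_Rscal : represents (Rscal G) (jRs g cn1).
Proof. by apply: repM (rep_cst _) _; apply: rep_sum => m; exact: rep_Riem. Qed.

Lemma rep_Aten i k : represents (Aten G i k) (jA g cn1 i k).
Proof.
apply: repB; first exact: rep_Riem.
by apply: repM rep_Rscal _; exact: rep_nat.
Qed.

Lemma rep_Weyl i k : represents (Weyl G i k) (jWeyl g cn1 cn2 i k).
Proof.
apply: repB; first exact: rep_Aten.
apply: repM (rep_yc i); apply: repM (rep_cst _) _.
by apply: rep_sum => m; apply: rep_py; exact: rep_Aten.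
Qed.

Lemma rep_Weyl4 j i p l : represents (Weyl4 G j i p l) (jWeyl4 g cn1 cn2 c3 j i p l).
Proof.
apply: rep_py; apply: repM (rep_cst _) _.
by apply: repB; apply: rep_py; exact: rep_Weyl.
Qed.

Lemma rep_weaklyWeyl j i k l :
  represents (weaklyWeylCurv G j i k l) (jWW g cn1 cn2 c3 j i k l).
Proof.
by apply: rep_sum => p; apply: repM (rep_yc p); apply: rep_py; exact: rep_Weyl4.
Qed.

Lemma rep_Douglas j i k l : represents (Douglas G j i k l) (jDoug g cn2 j i k l).
Proof.
do 3!apply: rep_py; apply: repB => //; apply: repM (rep_yc i).
by apply: repM (rep_cst _) _; apply: rep_sum => m; exact: rep_py.
Qed.

Lemma rep_hcov13 T t j i k l m : (forall j i k l, represents (T j i k l) (t j i k l)) ->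
  represents (hcov13 G T j i k l m) (jhcov13 g t j i k l m).
Proof.
move=> Tt; do 3!(apply: repB; last by apply: rep_sum => r; apply: repM => //; exact: rep_Berwald).
apply: repD; last by apply: rep_sum => r; apply: repM => //; exact: rep_Berwald.
apply: repB; first exact: rep_px.
by apply: rep_sum => r; apply: repM; [exact: rep_Nconn | exact: rep_py].
Qed.

Lemma rep_hcov13_Douglas j i k l : (forall i, homogeneous 2 (g i)) ->
  represents (fun z => \sum_m hcov13 G (Douglas G) j i k l m z * yc m z)
      (nab13 g (jDoug g cn2) j i k l).
Proof.
move=> homg; rewrite -(sum_jhcov13 homg).
apply: rep_sum => m; apply: repM (rep_yc m); apply: rep_hcov13.
exact: rep_Douglas.
Qed.

End SprayTransfer.
End TVJets.

(** * The spray of a Finsler metric *)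

Section FinslerSpray.
Variables (R : realType) (n : nat).
Local Notation TV := ('rV[R]_n * 'rV[R]_n)%type.

Definition TVbasis (i : 'I_n + 'I_n) : TV :=
  match i with inl q => (delta_mx ord0 q, 0) | inr q => (0, delta_mx ord0 q) end.

Definition TVcoord (i : 'I_n + 'I_n) (z : TV) : R :=
  match i with inl q => z.1 ord0 q | inr q => z.2 ord0 q end.

Lemma TVbasisE (z : TV) : z = \sum_i TVcoord i z *: TVbasis i.
Proof.
rewrite big_sumType /=; case: z => x y.
have -> : \sum_q ((x, y).1 ord0 q *: ((delta_mx ord0 q, 0) : TV)) = (x, 0).
  rewrite {2}(row_sum_delta x); apply: (big_ind2 (fun (s : TV) t => s = (t, 0))) => //.
    by move=> _ t _ t' -> ->; transitivity ((t + t', 0 + 0) : TV) => //; rewrite addr0.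
  move=> q _; transitivity ((x ord0 q *: delta_mx ord0 q, x ord0 q *: 0) : TV) => //.
  by rewrite scaler0.
have -> : \sum_q ((x, y).2 ord0 q *: ((0, delta_mx ord0 q) : TV)) = (0, y).
  rewrite {2}(row_sum_delta y); apply: (big_ind2 (fun (s : TV) t => s = (0, t))) => //.
    by move=> _ t _ t' -> ->; transitivity ((0 + 0, t + t') : TV) => //; rewrite addr0.
  move=> q _; transitivity ((y ord0 q *: 0, y ord0 q *: delta_mx ord0 q) : TV) => //.
  by rewrite scaler0.
by transitivity ((x + 0, 0 + y) : TV) => //; rewrite addr0 add0r.
Qed.

Variable U : opens TV.

(** Differentiate F (x, t y) = t F (x, y) at t = 1 by the chain rule. *)
Lemma hom1_homogeneous (F : TV -> R) (f : TVjets U) : represents F f ->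
  (forall z (c : R), U z -> 0 < c -> F (z.1, c *: z.2) = c * F z) -> homogeneous 1 f.
Proof.
move=> Ff Fh; apply: Cinf_eq => z Uz; rewrite mulr1z.
pose Phi (t : R) : TV := (z.1, t *: z.2).
have Phi1 : Phi 1 = z by rewrite /Phi scale1r; case: (z).
pose phi i (t : R) := TVcoord i (Phi t).
have phid i : is_derive (1 : R) 1 (phi i) (match i with inl q => 0 | inr q => z.2 ord0 q end).
  case: i => q; rewrite /phi /=; first exact: is_derive_cst.
  rewrite (_ : (fun t => _) = (fun t => t * z.2 ord0 q)); last by apply/funext => t; rewrite mxE.
  apply: DeriveDef; last by rewrite derive_lin ?mul1r // => a b h; rewrite /GRing.scale /=; ring.
  exact: derivableM.
have := @derivable_chain R TV R ('I_n + 'I_n)%type F Phi TVbasis phi 1 1.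
case.
- by move=> t; exact: TVbasisE.
- by move=> i; have [] := phid i.
- by move=> i; rewrite Phi1; exact: (@smooth_C1_along R _ U (oset_open U) F z _ (rep_smooth Ff) Uz).
move=> _; rewrite Phi1 big_sumType /=.
rewrite (near_eq_derive (g := fun t : R => t * F z)); last first.
  near=> t; rewrite /= Fh //; near: t.
  exact: lt_nbhsr.
rewrite derive_lin ?mul1r; last by move=> a b h; rewrite /GRing.scale /=; ring.
rewrite big1 ?add0r => [|q _]; last by rewrite (derive_val (is_derive := phid (inl q))) mul0r.
rewrite -Ff // => ->; rewrite -[LHS]/(evC Uz _) rmorph_sum.
apply: eq_bigr => q _; rewrite (derive_val (is_derive := phid (inr q))).
by rewrite [LHS]rmorphM; congr (_ * _); apply/esym; [exact: (rep_yc q) | exact: (rep_py q Ff)].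
Unshelve. all: by end_near. Qed.

(** Positive definiteness makes the determinant of the fundamental matrix nowhere zero, hence a unit
    of [Cinf U]; the adjugate then provides a smooth inverse. Multiplying the spray formula by this
    matrix gives the Euler-Lagrange equation. *)
Lemma finsler_spray (F : TV -> R) : smooth_on U F ->
  (forall z (c : R), U z -> 0 < c -> F (z.1, c *: z.2) = c * F z) ->
  (forall z (v : 'rV[R]_n), U z -> v != 0 -> 0 < (v *m fund F z *m v^T) ord0 ord0) ->
  exists (g : 'I_n -> TVjets U) (L : TVjets U) (h : 'I_n -> 'I_n -> TVjets U),
  [/\ forall i, represents (spray F i) (g i), represents (Fsq F) L, homogeneous 2 L,
      forall i, jS g (dy i L) = dx i L &
      forall k l, \sum_i h k i * dy l (dy i L) = (k == l)%:R].
Proof.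
move=> Fs Fh Fpos; have [f Ff] := smooth_rep Fs.
have homf : homogeneous 1 f by exact: hom1_homogeneous Ff Fh.
pose L := f * f.
have FL : represents (Fsq F) L by move=> z Uz; rewrite /Fsq expr2; exact: (repM Ff Ff).
have homL : homogeneous 2 L by exact: (homM homf homf).
pose half : TVjets U := ccst U 2^-1; pose quart : TVjets U := ccst U 4^-1.
have halfK : half * 2 = 1 by exact: (ccst_invK U (m := 2)).
have quartK : quart * 4 = 1 by exact: (ccst_invK U (m := 4)).
pose gm : 'M[TVjets U]_n := \matrix_(i, j) (half * dy j (dy i L)).
have gmE z (Uz : U z) : map_mx (evC Uz) gm = fund F z.
  apply/matrixP => i j; rewrite !mxE; apply/esym.
  exact: (repM (rep_cst 2^-1) (rep_py j (rep_py i FL)) Uz).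
have fund_unit z : U z -> fund F z \in unitmx.
  move=> Uz; rewrite unitmxE unitfE; apply/det0P => -[v v0 vF].
  by have := Fpos z v Uz v0; rewrite vF mul0mx mxE ltxx.
have [d dK] : exists d, (\det gm : Cinf U) * d = 1.
  apply: cinvP => z Uz; rewrite -[_ z]/(evC Uz _) -det_map_mx gmE.
  by have := fund_unit z Uz; rewrite unitmxE unitfE.
pose gi := d *: \adj gm.
have gmgi : gm *m gi = 1%:M.
  by rewrite /gi -scalemxAr mul_mx_adj scale_scalar_mx mulrC dK.
have gigm : gi *m gm = 1%:M by exact: mulmx1C.
have giE i l : represents (fun z => invmx (fund F z) i l) (gi i l).
  move=> z Uz; have : map_mx (evC Uz) gm *m map_mx (evC Uz) gi = 1%:M.
    by rewrite -map_mxM gmgi map_mx1.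
  rewrite gmE => /(congr1 (mulmx (invmx (fund F z)))).
  by rewrite mulKmx ?fund_unit // mulmx1 => <-; rewrite mxE.
pose e l := \sum_k dy l (dx k L) * yv k - dx l L.
pose g i := quart * \sum_l gi i l * e l.
(* [gm] is half the Hessian, so half of its inverse inverts the Hessian. *)
exists g, L, (fun k i => gi k i * half); split=> //.
- move=> i; apply: repM (rep_cst 4^-1) _; apply: rep_sum => l; apply: repM => //.
  apply: repB; last exact: rep_px.
  apply: rep_sum => k; apply: repM; last exact: rep_yc.
  by apply: rep_py; exact: rep_px.
- move=> i; have eE : e i = \sum_m 2 * (g m * dy m (dy i L)).
    have : \sum_m gm i m * (\sum_l gi m l * e l) = e i.
      under eq_bigr do rewrite mulr_sumr.
      rewrite exchange_big /= -[RHS](kron_sumr' e i); apply: eq_bigr => l _.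
      move/matrixP: gmgi => /(_ i l); rewrite !mxE => <-.
      by rewrite mulr_sumr; apply: eq_bigr => m _; ring.
    move=> <-; apply: eq_bigr => m _; rewrite mxE /g.
    transitivity (half * (quart * 4) * dy m (dy i L) * \sum_l gi m l * e l).
      by rewrite quartK; ring.
    transitivity (half * 2 * (2 * (quart * (\sum_l gi m l * e l) * dy m (dy i L)))).
      by ring.
    by rewrite halfK mul1r.
  rewrite /jS sumrB -eE /e opprB addrCA -sumrB big1 ?addr0 // => m _.
  by rewrite dxyC; ring.
- move=> k l; move/matrixP: gigm => /(_ k l); rewrite !mxE => <-.
  by apply: eq_bigr => i _; rewrite [gm _ _]mxE mulrA.
Qed.

End FinslerSpray.

(** * Pullbacks *)

Section Pullback.
Variables (R : realType) (n : nat).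
Local Notation TV := ('rV[R]_n * 'rV[R]_n)%type.
Variables (U U' : opens TV) (Phi : TV -> TV).
Hypothesis UU' : forall z, U z -> U' (Phi z).
Hypothesis phis : forall i, smooth_on U (fun z => TVcoord i (Phi z)).

Lemma pull_smooth (f : Cinf U') : smooth_on U (fun z => f (Phi z)).
Proof.
move=> k; apply: (Ck_comp k (oset_open U) (oset_open U') UU' _ phis (cf_smooth f)).
by move=> z; exact: TVbasisE.
Qed.

Definition pull (f : Cinf U') : Cinf U := to_Cinf (pull_smooth f).
Local Notation p := pull.

Lemma pullE f z : U z -> p f z = f (Phi z).
Proof. exact: to_CinfE. Qed.

Fact pull_additive : additive p.
Proof.
move=> f g; apply: Cinf_eq => z Uz; have Uz' := UU' Uz.
by rewrite caddE // coppE // !pullE // caddE // coppE.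
Qed.
Fact pull_multiplicative : multiplicative p.
Proof.
split=> [f g|]; apply: Cinf_eq => z Uz; have Uz' := UU' Uz.
  by rewrite cmulE // !pullE // cmulE.
by rewrite pullE // !ccstE.
Qed.
HB.instance Definition _ := GRing.isAdditive.Build (Cinf U') (Cinf U) p pull_additive.
HB.instance Definition _ :=
  GRing.isMultiplicative.Build (Cinf U') (Cinf U) p pull_multiplicative.

Definition phiC i : Cinf U := to_Cinf (phis i).

Lemma cD_pull u f : cD u (p f) = \sum_i cD u (phiC i) * p (cD (TVbasis R i) f).
Proof.
apply: Cinf_eq => z Uz; rewrite cDE //.
rewrite (near_eq_derive (g := f \o Phi)); last first.
  near=> y; apply: to_CinfE.
  by near: y; apply: open_nbhs_nbhs; split=> //; exact: oset_open.
have fC1 i : C1_along f (Phi z) (TVbasis R i).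
  exact: (@smooth_C1_along R _ U' (oset_open U') f _ _ (cf_smooth f) (UU' Uz)).
have dphi i : derivable (fun y => TVcoord i (Phi y)) z u.
  exact: smooth_derivable (phis i) Uz.
have [_ ->] := @derivable_chain R TV TV _ f Phi (@TVbasis R n)
  (fun i y => TVcoord i (Phi y)) z u (fun y => TVbasisE (Phi y)) dphi fC1.
rewrite -[RHS]/(evC Uz _) rmorph_sum; apply: eq_bigr => i _.
rewrite [RHS]rmorphM; congr (_ * _); apply/esym; last first.
  by transitivity (cD (TVbasis R i) f (Phi z)); [exact: pullE | apply: cDE; exact: UU'].
transitivity ('D_u (phiC i : TV -> R) z); first exact: cDE.
apply: near_eq_derive; near=> y; apply: to_CinfE.
by near: y; apply: open_nbhs_nbhs; split=> //; exact: oset_open.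
Unshelve. all: by end_near. Qed.

Lemma cD_pull_split u f : cD u (p f) =
  \sum_q cD u (phiC (inl q)) * p (cD (delta_mx ord0 q, 0) f) +
  \sum_q cD u (phiC (inr q)) * p (cD (0, delta_mx ord0 q) f).
Proof. by rewrite cD_pull big_sumType. Qed.

End Pullback.

(** * Pullback along a fibrewise linear map *)

Section FibreLinear.
Variables (R : realType) (n : nat).
Local Notation TV := ('rV[R]_n * 'rV[R]_n)%type.
Variables (U U' : opens TV) (Phi : TV -> TV).
Hypothesis UU' : forall z, U z -> U' (Phi z).
Hypothesis phis : forall i, smooth_on U (fun z => TVcoord i (Phi z)).
Local Notation A := (TVjets U).
Local Notation B := (TVjets U').
Definition pullJ : {rmorphism B -> A} := pull UU' phis.
Definition baseC q : A := phiC phis (inl q).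
(** Defined as a derivative of base coordinates, so that the symmetry [dx_jacC] is commutation of
    the [dx]. *)
Definition jacC j q : A := dx j (baseC q).
Hypothesis dy_base : forall k q, dy k (baseC q) = 0.
Hypothesis fibreE : forall q, (phiC phis (inr q) : A) = \sum_j yv j * jacC j q.

Lemma dy_jacC k j q : dy k (jacC j q) = 0.
Proof. by rewrite /jacC -dxyC dy_base raddf0. Qed.

Lemma dx_jacC k j q : dx k (jacC j q) = dx j (jacC k q).
Proof. exact: dxC. Qed.

Lemma pullJ_yv q : pullJ (yv q) = \sum_j yv j * jacC j q.
Proof.
rewrite -fibreE; apply: Cinf_eq => z Uz.
by rewrite [LHS]pullE // to_CinfE ?to_CinfE //; exact: UU'.
Qed.

Lemma pullJ_dy k f : dy k (pullJ f) = \sum_q jacC k q * pullJ (dy q f).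
Proof.
transitivity (\sum_q dy k (baseC q) * pullJ (dx q f) +
    \sum_q dy k (phiC phis (inr q) : A) * pullJ (dy q f)).
  exact: cD_pull_split.
rewrite [X in X + _]big1 ?add0r => [|q _]; last by rewrite dy_base mul0r.
apply: eq_bigr => q _; congr (_ * _).
transitivity (dy k (\sum_j yv j * jacC j q : A)); first by rewrite -fibreE.
rewrite raddf_sum; under eq_bigr do rewrite dyM dy_yv dy_jacC mulr0 addr0.
exact: kron_suml.
Qed.

Lemma pullJ_dx k f : dx k (pullJ f) = \sum_q jacC k q * pullJ (dx q f) +
  \sum_q (\sum_r yv r * dx k (jacC r q)) * pullJ (dy q f).
Proof.
transitivity (\sum_q dx k (baseC q) * pullJ (dx q f) +
    \sum_q dx k (phiC phis (inr q) : A) * pullJ (dy q f)).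
  exact: cD_pull_split.
congr (_ + _); apply: eq_bigr => q _; congr (_ * _).
transitivity (dx k (\sum_j yv j * jacC j q : A)); first by rewrite -fibreE.
rewrite raddf_sum; apply: eq_bigr => j _.
by rewrite dxM dx_yv mul0r add0r.
Qed.
End FibreLinear.

(** * Components of vector-valued maps and the Jacobian matrix *)

Section Components.
Variables (R : realType) (n m : nat).
Local Notation V := 'rV[R]_n.

Lemma smooth_coord (O : set V) (f : V -> 'rV[R]_m) q : open O -> smooth_on O f ->
  smooth_on O (fun x => f x ord0 q).
Proof.
move=> oO fs k; have fk := fs k; elim: k f fk {fs} => [|k IH] f [fc fd]; (split=> [x Ox|]) => //;
  try by apply: (@continuous_comp _ _ _ f (fun y : 'rV[R]_m => y ord0 q));
    [exact: fc | exact: coord_continuous].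
move=> v; have [fv fvk] := fd v; split=> [x Ox|].
  by move: (fv x Ox) => /derivable_mxP; apply.
apply: (Ck_eq oO (f := fun x => ('D_v f x) ord0 q)); last exact: IH.
by move=> x Ox; rewrite derive_mx ?mxE //; exact: fv.
Qed.

Lemma smooth_fst (W : normedModType R) (O : set V) (f : V -> R) : smooth_on O f ->
  smooth_on [set z : V * W | O z.1] (fun z => f z.1).
Proof.
move=> fs k; have fk := fs k; elim: k f fk {fs} => [|k IH] f [fc fd]; (split=> [x Ox|]) => //;
  try by apply: (@continuous_comp _ _ _ fst f); [exact: cvg_fst | exact: fc].
move=> v; have [fv fvk] := fd v.1; split=> [x Ox|].
  exact: fv x.1 Ox.
exact: (IH (fun x => 'D_(v.1) f x)).
Qed.

(** The Jacobian matrix is defined through the differential, so continuous partial derivatives have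
    to be upgraded to differentiability; [strictly_derivable_sum] supplies the little-o estimate. *)
Lemma C1_differentiable (g : V -> R) x :
  (forall i, C1_along g x (delta_mx ord0 i)) -> differentiable g x.
Proof.
move=> gC1; pose D i := 'D_(delta_mx ord0 i : V) g x.
pose df (h : V) := \sum_i h ord0 i * D i.
have df_lin : linear df.
  move=> a u v; rewrite /df scaler_sumr -big_split; apply: eq_bigr => i _ /=.
  by rewrite !mxE /GRing.scale /=; ring.
pose dfL : {linear V -> R} := HB.pack df (GRing.isLinear.Build R V R _ df df_lin).
have dfc : continuous df.
  move=> h; have : df y @[y --> nbhs h] --> df h.
    apply: cvg_big => [|i _]; first exact: add_continuous.
    by apply: cvgMr_tmp; exact: coord_continuous.
  exact.
have H : g \o shift x = cst (g x) + dfL +o_ (0 : V) id.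
  apply/eqaddoP => e e0.
  (* The error is summed over n coordinates, each at most |h|; n + 1 keeps the divisor positive. *)
  have en0 : 0 < e / (n%:R + 1) by rewrite divr_gt0 // ltr_wpDl.
  have [d d0 dH] := strictly_derivable_sum (index_enum 'I_n) gC1 en0.
  have : \forall h \near (0 : V), `|h| < d by exact: nbhs0_lt.
  apply: filterS => h hd.
  have hi i : `|h ord0 i| <= `|h|.
    by rewrite [leRHS]/Num.Def.normr /= mx_normrE; exact: (le_bigmax _ _ (ord0, i)).
  have := dH (fun i => h ord0 i) (fun i => le_lt_trans (hi i) hd).
  rewrite -row_sum_delta => le1.
  rewrite [X in `|X|](_ : _ = g (x + h) - g x - df h); last first.
    by transitivity (g (h + x) - (g x + df h)) => //; rewrite (addrC h) opprD addrA.
  apply: le_trans le1 _; rewrite -mulrA ler_pM2l // ler_pdivrMl ?ltr_wpDl //.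
  apply: (@le_trans _ _ (\sum_(i < n) `|h|)); first by apply: ler_sum.
  by rewrite sumr_const card_ord mulrDl mul1r -mulr_natl; have := normr_ge0 h; rewrite /=; lra.
have dfE := @diff_unique R V R g dfL x dfc H.
by apply/diff_locallyP; rewrite dfE.
Unshelve. all: by end_near. Qed.

Lemma differentiable_row (f : V -> 'rV[R]_m) x :
  (forall q, differentiable (fun x => f x ord0 q) x) -> differentiable f x.
Proof.
move=> fq; rewrite (_ : f = \sum_(q < m) (fun x => f x ord0 q *: (delta_mx ord0 q : 'rV[R]_m))).
  by apply: differentiable_sum => q; exact: differentiableZl.
by apply/funext => y; rewrite fct_sumE -row_sum_delta.
Qed.

Lemma jacobianE (O : set V) (f : V -> 'rV[R]_m) x j q : open O -> smooth_on O f -> O x ->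
  'J f x j q = 'D_(delta_mx ord0 j : V) (fun x => f x ord0 q) x.
Proof.
move=> oO fs Ox; have df : differentiable f x.
  apply: differentiable_row => p; apply: C1_differentiable => i.
  exact: (smooth_C1_along oO _ (smooth_coord p oO fs) Ox).
rewrite /jacobian mxE -deriveE // derive_mx ?mxE //.
exact: diff_derivable.
Qed.
End Components.

(** * Transition maps *)

Section Transition.
Variables (R : realType) (n : nat) (M : smooth_manifold R n).
Local Notation TV := ('rV[R]_n * 'rV[R]_n)%type.
Implicit Types (a b : chart M) (z : TV).

Lemma chart_overlap_open a b : open (phi a @` (dom a `&` dom b)).
Proof.
have -> : phi a @` (dom a `&` dom b) = (phi a @` dom a) `&` psi a @^-1` dom b.
  apply/seteqP; split=> [_ [p [pa pb] <-]|_ [[p pa <-] pb]].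
    by split; [exists p | rewrite /= phiK].
  by exists p => //; split=> //; move: pb; rewrite /= phiK.
rewrite openE => x [xa xb]; apply: filterI.
  exact: open_nbhs_nbhs (conj (@img_open _ _ _ a) xa).
have := @psi_continuous _ _ _ a; rewrite continuous_open_subspace; last exact: img_open.
move=> /(_ x); rewrite inE => /(_ xa); apply.
exact: open_nbhs_nbhs (conj (@dom_open _ _ _ b) xb).
Qed.

Lemma TMoverlap_open a b : open (TMoverlap a b).
Proof.
rewrite openE => z zab.
have h : nbhs z.1 (phi a @` (dom a `&` dom b)).
  by apply: open_nbhs_nbhs; split; [exact: chart_overlap_open | exact: zab].
exact: (@cvg_fst _ _ (nbhs z.1) (nbhs z.2) _ _ h).
Qed.

Lemma nonzero_fibre_open : open [set z : TV | z.2 != 0].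
Proof.
rewrite openE => z /= z0.
have h : \forall y \near z.2, y != 0.
  apply/near_normP; exists `|z.2|; first by rewrite normr_gt0.
  by move=> y; apply: contraTneq => ->; rewrite sub0r normrN ltxx.
exact: (@cvg_snd _ _ (nbhs z.1) (nbhs z.2) _ _ h).
Qed.

Lemma TMchart_overlap a : TMchart a = TMoverlap a a.
Proof. by rewrite /TMchart /TMoverlap setIid. Qed.

Lemma slit_open a : open (slit a).
Proof.
rewrite (_ : slit a = TMoverlap a a `&` [set z | z.2 != 0]).
  by apply: openI; [exact: TMoverlap_open | exact: nonzero_fibre_open].
by rewrite -TMchart_overlap.
Qed.

Definition slit_overlap a b : opens TV := Opens
  (openI (@TMoverlap_open a b) nonzero_fibre_open).

Lemma TMoverlap_TMchart a b z : TMoverlap a b z -> TMchart a z.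
Proof. by move=> [p [pa _] pz]; exists p. Qed.

Lemma TMchange_overlap a b z : TMoverlap a b z -> TMoverlap b a (TMchange a b z).
Proof.
by move=> [p [pa pb] pz]; exists p => //; rewrite /TMchange /= -pz phiK.
Qed.

Lemma transitionK a b z : TMoverlap a b z -> phi a (psi b (TMchange a b z).1) = z.1.
Proof. by move=> [p [pa pb] pz]; rewrite /TMchange /= -pz !phiK. Qed.

Lemma chart_jacE a b z j q : TMoverlap a b z -> chart_jac a b z j q =
  'D_(delta_mx ord0 j : 'rV[R]_n) (fun x => (phi b (psi a x)) ord0 q) z.1.
Proof.
by move=> zab; exact: (jacobianE j q (@chart_overlap_open a b) (@transition_smooth _ _ M a b) zab).
Qed.

Lemma TMchange_smooth a b i : smooth_on (TMoverlap a b) (fun z => TVcoord i (TMchange a b z)).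
Proof.
have fq q := smooth_coord q (@chart_overlap_open a b) (@transition_smooth _ _ M a b).
case: i => q /=; first exact: (smooth_fst _ (fq q)).
move=> k; apply: (Ck_eq (@TMoverlap_open a b) (f := fun z => \sum_j yc j z *
  'D_(delta_mx ord0 j : 'rV[R]_n) (fun x => (phi b (psi a x)) ord0 q) z.1)).
  by move=> z zab; rewrite mxE; apply: eq_bigr => j _; rewrite chart_jacE.
apply: Ck_sum; first exact: TMoverlap_open.
move=> j; apply: CkM; [exact: TMoverlap_open | exact: yc_smooth |].
exact: (smooth_fst _ (smooth_derive _ (fq q))).
Qed.

Section Pull.
Variables (a b : chart M) (U U' : opens TV).
Hypothesis Uab : forall z, U z -> TMoverlap a b z.
Hypothesis UU' : forall z, U z -> U' (TMchange a b z).

Lemma TMchange_smoothU i : smooth_on U (fun z => TVcoord i (TMchange a b z)).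
Proof. by move=> k; apply: Ck_subset (@TMchange_smooth a b i k) => z; exact: Uab. Qed.

Local Notation phis := TMchange_smoothU.

Lemma dx_baseC j q z : U z -> (jacC phis j q : Cinf U) z = chart_jac a b z j q.
Proof.
move=> Uz; have rb : represents (fun z => (phi b (psi a z.1)) ord0 q) (baseC phis q : TVjets U).
  by move=> y Uy; rewrite to_CinfE.
rewrite -(rep_px j rb Uz) chart_jacE //; exact: Uab.
Qed.

Lemma dy_baseC k q : dy k (baseC phis q) = 0.
Proof.
have rb : represents (fun z => (phi b (psi a z.1)) ord0 q) (baseC phis q : TVjets U).
  by move=> y Uy; rewrite to_CinfE.
apply: Cinf_eq => z Uz; rewrite -(rep_py k rb Uz) ccstE //.
exact: (derive0 (fun x => (phi b (psi a x)) ord0 q) z.1).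
Qed.

Lemma fibreC q : (phiC phis (inr q) : TVjets U) = \sum_j yv j * jacC phis j q.
Proof.
apply: Cinf_eq => z Uz; rewrite to_CinfE //= mxE -[RHS]/(evC Uz _) rmorph_sum.
apply: eq_bigr => j _; rewrite [RHS]rmorphM; congr (_ * _).
  exact: (rep_yc j Uz).
exact/esym/dx_baseC.
Qed.
End Pull.

(* Differentiate the coordinates [x^q], written as those of chart [a] pulled back
   along the two transition maps. *)
Lemma chart_jacK a b z : TMoverlap a b z ->
  chart_jac a b z *m chart_jac b a (TMchange a b z) = 1%:M.
Proof.
move=> zab.
pose U := Opens (@TMoverlap_open a b); pose U' := Opens (@TMoverlap_open b a).
have UU' y : U y -> U' (TMchange a b y) by exact: TMchange_overlap.
have Uab y : U y -> TMoverlap a b y by [].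
have Uba y : U' y -> TMoverlap b a y by [].
pose p : {rmorphism TVjets U' -> TVjets U} := pullJ UU' (TMchange_smoothU Uab).
apply/matrixP => k q; rewrite !mxE.
pose x : Cinf U := p (baseC (TMchange_smoothU Uba) q).
have xE : represents (fun z => z.1 ord0 q) (x : TVjets U).
  move=> y Uy; rewrite pullE // to_CinfE; last exact: TMchange_overlap.
  by rewrite /= transitionK.
have dxE : (dx k (x : TVjets U) : Cinf U) z = (k == q)%:R.
  rewrite -(rep_px k xE zab).
  transitivity ((delta_mx ord0 k : 'rV[R]_n) ord0 q).
    rewrite /px derive_lin // => u v h /=; by rewrite !mxE.
  by rewrite mxE eqxx /= eq_sym.
rewrite -dxE /x (pullJ_dx UU' (fibreC Uab)).
rewrite [X in _ = _ (_ + X) _]big1 ?addr0; last first.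
  by move=> r _; rewrite dy_baseC raddf0 mulr0.
rewrite -[RHS]/(evC (zab : U z) _) rmorph_sum; apply: eq_bigr => r _.
rewrite [RHS]rmorphM; congr (_ * _); first exact/esym/dx_baseC.
by apply/esym; rewrite [LHS]pullE // dx_baseC //; exact: TMchange_overlap.
Qed.

Lemma TMchange_fibre_neq0 a b z : TMoverlap a b z -> z.2 != 0 -> (TMchange a b z).2 != 0.
Proof.
move=> zab; apply: contra_neq => /= h.
by rewrite -[LHS]mulmx1 -(chart_jacK zab) mulmxA h mul0mx.
Qed.

Lemma slit_overlap_change a b z : slit_overlap a b z -> slit_overlap b a (TMchange a b z).
Proof.
by move=> [zab z0]; split; [exact: TMchange_overlap | exact: TMchange_fibre_neq0].
Qed.
End Transition.

(** * The generalized Sakaguchi theorem *)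

Lemma sum_rev3 (V : nmodType) (I : finType) (f : I -> I -> I -> V) :
  \sum_s \sum_r \sum_i f i r s = \sum_i \sum_r \sum_s f i r s.
Proof.
transitivity (\sum_s \sum_i \sum_r f i r s).
  by apply: eq_bigr => s _; exact: exchange_big.
rewrite exchange_big; apply: eq_bigr => i _; exact: exchange_big.
Qed.

Section Sakaguchi.
Variables (R : realType) (n : nat) (M : smooth_manifold R n).
Local Notation TV := ('rV[R]_n * 'rV[R]_n)%type.
Variable F : chart M -> TV -> R.
Hypothesis hF : finsler_metric F.
Implicit Types (a b : chart M) (z : TV).

Definition Douglas_dot a j i k l z :=
  \sum_m hcov13 (spray (F a)) (Douglas (spray (F a))) j i k l m z * yc m z.

(** [U] is arbitrary so that the same lemma serves a whole chart and an overlap of two charts. *)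
Lemma finsler_spray_slit a (U : opens TV) : (forall z, U z -> slit a z) ->
  exists (g : 'I_n -> TVjets U) (L : TVjets U) (h : 'I_n -> 'I_n -> TVjets U),
  [/\ forall i, represents (spray (F a) i) (g i), represents (Fsq (F a)) L, forall i, homogeneous 2 (g i),
      forall i, jS g (dy i L) = dx i L &
      forall k l, \sum_i h k i * dy l (dy i L) = (k == l)%:R].
Proof.
move=> Us; have Fs : smooth_on U (F a).
  by move=> k; apply: Ck_subset (finsler_smooth hF a k) => z /Us.
have [z c Uz c0|z v Uz v0|g [L [h [gE LE homL EL hK]]]] := @finsler_spray R n U (F a) Fs.
- by apply: (finsler_homogeneous hF) => //; have [] := Us z Uz.
- exact: (finsler_convex hF (Us z Uz) v0).
exists g, L, h; split=> // i.
apply: (euler_lagrange_hom homL EL hK (h2 := ccst U 2^-1)).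
exact: (ccst_invK U (m := 2)).
Qed.

Lemma Douglas_dot_weaklyWeyl a : exists c : 'I_n -> 'I_n -> 'I_n -> TV -> R,
  (forall j k l, smooth_on (slit a) (c j k l)) /\
  forall z j i k l, slit a z -> Douglas_dot a j i k l z =
    weaklyWeylCurv (spray (F a)) j i k l z + c j k l z * yc i z.
Proof.
pose U : opens TV := Opens (@slit_open _ _ M a).
have [//|g [L [h [gE LE homg EL hK]]]] := @finsler_spray_slit a U.
pose corr j k l := jcorr g (cn1 U) (cn2 U) (c3 U) j k l.
exists (fun j k l => corr j k l : Cinf U); split=> [j k l|z j i k l za].
  exact: (cf_smooth (corr j k l : Cinf U)).
rewrite /Douglas_dot (rep_hcov13_Douglas gE _ _ _ _ homg za).
rewrite (nab_Doug_weaklyWeyl homg (c1 := cn1 U) (t3 := c3 U)); try exact: jconst_cst; last first.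
  by rewrite mulrC; exact: (ccst_invK U (m := 3)).
rewrite -[LHS]/(evC (za : U z) _) rmorphD; congr (_ + _).
  exact/esym/(rep_weaklyWeyl gE).
by rewrite rmorphM; congr (_ * _); exact/esym/(@rep_yc _ _ U).
Qed.

Lemma Douglas_dot_change a b z q j k l : TMoverlap a b z -> z.2 != 0 ->
  \sum_i chart_jac a b z i q * Douglas_dot a j i k l z =
  \sum_p \sum_r \sum_s chart_jac a b z j p * chart_jac a b z k r * chart_jac a b z l s *
     Douglas_dot b p q r s (TMchange a b z).
Proof.
move=> zab z0; pose U := slit_overlap a b; pose U' := slit_overlap b a.
have Uz : U z by [].
have UU' y : U y -> U' (TMchange a b y) by exact: slit_overlap_change.
have Uab y : U y -> TMoverlap a b y by case.
have Uba y : U' y -> TMoverlap b a y by case.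
have [y [/TMoverlap_TMchart]|g [L [h [gE LE homg EL hK]]]] := @finsler_spray_slit a U.
  by split.
have [y [/TMoverlap_TMchart]|g' [L' [h' [gE' LE' homg' EL' hK']]]] := @finsler_spray_slit b U'.
  by split.
pose p : {rmorphism TVjets U' -> TVjets U} := pullJ UU' (TMchange_smoothU Uab).
pose J := jacC (TMchange_smoothU Uab).
pose K i m : TVjets U := p (jacC (TMchange_smoothU Uba) i m).
(* The scalar law of F makes F^2 one common Lagrangian for the sprays of both charts. *)
have pL : p L' = L.
  apply: Cinf_eq => y Uy; rewrite -LE // [LHS]pullE // -LE'; last exact: slit_overlap_change.
  by rewrite /Fsq (finsler_scalar hF) //; exact: (Uab _ Uy).
have JE i m y : U y -> (J i m : Cinf U) y = chart_jac a b y i m by exact: dx_baseC.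
have KE i m y : U y -> (K i m : Cinf U) y = chart_jac b a (TMchange a b y) i m.
  by move=> Uy; rewrite [LHS]pullE // dx_baseC //; exact: slit_overlap_change.
have JKE i m : \sum_r J i r * K r m = (i == m)%:R.
  apply: Cinf_eq => y Uy; rewrite -[LHS]/(evC Uy _) -[RHS]/(evC Uy _) rmorph_sum rmorph_nat.
  have /matrixP/(_ i m) := chart_jacK (Uab _ Uy); rewrite !mxE => <-.
  apply: eq_bigr => r _; rewrite [LHS]rmorphM.
  by congr (_ * _); [exact: JE | exact: KE].
have KJE i m : \sum_r K i r * J r m = (i == m)%:R.
  apply: Cinf_eq => y Uy; rewrite -[LHS]/(evC Uy _) -[RHS]/(evC Uy _) rmorph_sum rmorph_nat.
  have /mulmx1C/matrixP/(_ i m) := chart_jacK (Uab _ Uy); rewrite !mxE => <-.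
  apply: eq_bigr => r _; rewrite [LHS]rmorphM.
  by congr (_ * _); [exact: KE | exact: JE].
have half2 : (ccst U 2^-1 : TVjets U) * 2 = 1.
  exact: (ccst_invK U (m := 2)).
have pc : p (cn2 U') = cn2 U.
  by apply: Cinf_eq => y Uy; rewrite [LHS]pullE // !ccstE //; exact: slit_overlap_change.
have ELA i : jS g (dy i (p L')) = dx i (p L') by rewrite pL.
have := nab_Doug_change (dy_jacC (dy_baseC Uab)) (dx_jacC _) JKE KJE
  (pullJ_yv UU' (fibreC Uab)) (pullJ_dy UU' (dy_baseC Uab) (fibreC Uab))
  (pullJ_dx UU' (fibreC Uab)) ELA EL' hK' half2 (jconst_cst _ _)
  (jconst_cst _ _) pc q j k l.
move=> /(congr1 (evC Uz)); rewrite rmorph_sum => E.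
transitivity (evC Uz (contrJ3 J
    (fun i m d => p (nab13 g' (jDoug g' (cn2 U')) i q m d)) j k l)).
  rewrite -E; apply: eq_bigr => i _; rewrite [RHS]rmorphM; congr (_ * _).
    exact/esym/JE.
  exact: (rep_hcov13_Douglas gE _ _ _ _ homg Uz).
rewrite /contrJ3 /contrJ rmorph_sum.
transitivity (\sum_s \sum_r \sum_i chart_jac a b z j i * chart_jac a b z k r *
    chart_jac a b z l s * Douglas_dot b i q r s (TMchange a b z)).
  apply: eq_bigr => s _; rewrite rmorphM rmorph_sum mulr_sumr.
  apply: eq_bigr => r _; rewrite rmorphM rmorph_sum !mulr_sumr.
  apply: eq_bigr => i _; rewrite rmorphM.
  transitivity (chart_jac a b z l s * (chart_jac a b z k r * (chart_jac a b z j i *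
      Douglas_dot b i q r s (TMchange a b z)))); last by ring.
  congr (_ * (_ * (_ * _))); try exact: JE.
  transitivity ((nab13 g' (jDoug g' (cn2 U')) i q r s : Cinf U') (TMchange a b z)).
    exact: pullE.
  exact/esym/(rep_hcov13_Douglas gE' _ _ _ _ homg' (UU' _ Uz)).
exact: (sum_rev3 (fun i r s => chart_jac a b z j i * chart_jac a b z k r *
  chart_jac a b z l s * Douglas_dot b i q r s (TMchange a b z))).
Qed.
End Sakaguchi.

Theorem theorem2p4 (R : realType) (n : nat) (hn : (2 <= n)%N)
    (M : smooth_manifold R n) (F : chart M -> 'rV[R]_n * 'rV[R]_n -> R)
    (hF : finsler_metric F) :
  weakly_Weyl F -> GDW F.
Proof.
move=> [omega [mu [[omega_smooth _] _ HW _]]].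
have [c Hc] := choice (Douglas_dot_weaklyWeyl hF).
pose T a j k l z := omega a j k l z + c a j k l z.
have TE a z j i k l : slit a z -> Douglas_dot F a j i k l z = T a j k l z * yc i z.
  by move=> az; rewrite (Hc a).2 // HW // mulrDl.
exists T => //; split=> [a j k l m|a b z j k l zab z0].
  by apply: CkD; [exact: slit_open | exact: omega_smooth | exact: (Hc a).1].
have az : slit a z by split=> //; exact: TMoverlap_TMchart zab.
have bz : slit b (TMchange a b z).
  split; last exact: TMchange_fibre_neq0.
  exact: TMoverlap_TMchart (TMchange_overlap zab).
(* Off the zero section some y'^q is nonzero; cancelling it recovers the law of T from that of T
   y'^q. *)
have [q yq] : exists q, yc q (TMchange a b z) != 0.
  apply/existsP; rewrite -[X in is_true X]negbK negb_exists; apply/negP => /forallP y0.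
  move/eqP: bz.2; apply; apply/rowP => q; rewrite [RHS]mxE.
  by apply/eqP; have := y0 q; rewrite negbK.
apply: (mulIf yq).
(* Since y'^q is the sum of y^i J_i^q, T y'^q is the upper index of the Douglas derivative
   contracted with J. *)
transitivity (\sum_i chart_jac a b z i q * Douglas_dot F a j i k l z).
  rewrite /yc /= mxE mulr_sumr; apply: eq_bigr => i _.
  by rewrite TE //; rewrite /yc; ring.
rewrite Douglas_dot_change // mulr_suml; apply: eq_bigr => p _.
rewrite mulr_suml; apply: eq_bigr => r _; rewrite mulr_suml; apply: eq_bigr => s _.
by rewrite TE // mulrA.
Qed.
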